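(* Let $k\in\mathbb{N}$ and $C_\square:=(k)_2^2\,2^{\binom{k}{2}}$, where $(k)_2=k(k-1)$. Let $\mathcal{R}$ be a rule of order $k$ and let $U,W\in\mathcal{W}_0$ be any graphons. If $t\in I_U\cap I_W$, then $$\|\Phi^tU-\Phi^tW\|_\square\le e^{C_\square|t|}\,\|U-W\|_\square .$$
   Context: $(\Omega,\pi)$ is a fixed atomless probability space whose sigma-algebra is separable (there is a countable family $\mathcal{C}$ of measurable sets such that for every measurable $S$ and $\delta>0$ some $T\in\mathcal{C}$ has $\pi(S\ominus T)<\delta$). $\mathcal{W}$ is the Banach space of kernels: bounded measurable functions $W:\Omega^2\to\mathbb{R}$ with $W(x,y)=W(y,x)$ a.e., identified when equal a.e., with the $L^\infty$-norm $\|\cdot\|_\infty$. $\mathcal{W}_0\subset\mathcal{W}$ is the set of graphons: kernels with values in $[0,1]$ a.e. The cut norm is $\|W\|_\square=\sup_{A,B\subseteq\Omega}\left|\int_{A\times B}W\,\mathrm{d}\pi^2\right|$ (supremum over measurable sets). $\mathcal{H}_k$ is the set of all (simple, labelled) graphs on vertex set $[k]$. A rule of order $k$ is a matrix $\mathcal{R}\in[0,1]^{\mathcal{H}_k\times\mathcal{H}_k}$ with $\sum_{J}\mathcal{R}_{H,J}=1$ for every $H\in\mathcal{H}_k$. For $F\in\mathcal{H}_k$, distinct $a,b\in[k]$ and $W\in\mathcal{W}$ define $$(T_F^{a,b}W)(x,y)=\int\prod_{ij\in E(F)}W(x_i,x_j)\prod_{ij\notin E(F)}(1-W(x_i,x_j))\prod_{i\in[k]\setminus\{a,b\}}\pi(\mathrm{d}x_i),\quad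 x_a=x,\ x_b=y,$$ where $ij$ ranges over unordered pairs of distinct elements of $[k]$. The velocity operator $\mathfrak{V}=\mathfrak{V}_{\mathcal{R}}:\mathcal{W}\to\mathcal{W}$ is $$\mathfrak{V}_{\mathcal{R}}W=\sum_{F,H\in\mathcal{H}_k}\mathcal{R}_{F,H}\sum_{1\le a\ne b\le k}T_F^{a,b}W\cdot\left(\mathbb{I}_{\{ab\in E(H)\setminus E(F)\}}-\mathbb{I}_{\{ab\in E(F)\setminus E(H)\}}\right),$$ the inner sum being over ordered pairs. For $W\in\mathcal{W}$, $\Phi^{\cdot}W:\mathcal{D}_W\to\mathcal{W}$ denotes the (unique) maximal solution, on an open interval $\mathcal{D}_W\ni 0$, of $\frac{\mathrm{d}}{\mathrm{d}t}\Phi^tW=\mathfrak{V}\Phi^tW$, $\Phi^0W=W$ (derivative with respect to $\|\cdot\|_\infty$); it exists for every kernel $W$. For a graphon $W$, $I_W:=\{t\in\mathcal{D}_W:\Phi^tW\in\mathcal{W}_0\}$, which is a closed interval containing $[0,\infty)$. *)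

(* Defs.v *)
From HB Require Import structures.
From mathcomp Require Import all_boot all_order all_algebra.
From mathcomp Require Import all_classical all_reals all_analysis.

Set Implicit Arguments.
Unset Strict Implicit.
Unset Printing Implicit Defensive.
Import Order.TTheory GRing.Theory Num.Theory.
Import numFieldNormedType.Exports.
Local Open Scope classical_set_scope.
Local Open Scope ring_scope.

(* A simple labelled graph on [k], given by its set of edges. *)
Definition lgraph (k : nat) : predArgType :=
  {E : {set {set 'I_k}} | [forall e in E, #|e| == 2%N]}.

Definition edge (k : nat) (F : lgraph k) (i j : 'I_k) : bool :=
  [set i; j]%SET \in val F.

Definition is_rule (R : realType) (k : nat)
    (rule : lgraph k -> lgraph k -> R) : Prop :=
  (forall F H, 0 <= rule F H <= 1) /\ (forall F, \sum_H rule F H = 1).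

Section probability_space.
Context (d : measure_display) (Omega : measurableType d) (R : realType).
Variable P : probability Omega R.

Definition atomless : Prop :=
  forall A : set Omega, measurable A -> (0 < P A)%E ->
  exists B, [/\ measurable B, B `<=` A & (0 < P B < P A)%E].

Definition separable_space : Prop :=
  exists C : set (set Omega),
  [/\ countable C, C `<=` measurable &
    forall S (delta : R), measurable S -> 0 < delta ->
    exists2 T, C T & (P (S `+` T) < delta%:E)%E].

(* Kernels are represented by functions; the identification of a.e. equal
   functions is made explicit wherever kernels are compared. *)
Definition is_kernel (W : Omega * Omega -> R) : Prop :=
  [/\ measurable_fun setT W,
      [bounded W z | z in [set: Omega * Omega]] &
      \forall z \ae (P \x P)%E, W (z.1, z.2) = W (z.2, z.1)].

Definition is_graphon (W : Omega * Omega -> R) : Prop :=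
  is_kernel W /\ \forall z \ae (P \x P)%E, 0 <= W z <= 1.

Definition cut_norm (W : Omega * Omega -> R) : R :=
  sup [set `|\int[(P \x P)%E]_(z in AB.1 `*` AB.2) W z|
      | AB in [set AB : set Omega * set Omega |
                measurable AB.1 /\ measurable AB.2]].

(* Integration of f against P in each of the coordinates listed in s, the
   remaining coordinates being fixed to those of x. *)
Fixpoint coord_integral (k : nat) (s : seq 'I_k)
    (f : ('I_k -> Omega) -> R) (x : 'I_k -> Omega) : R :=
  if s is i :: s' then
    \int[P]_u coord_integral s' f [eta x with i |-> u]
  else f x.

(* As W is symmetric only up to a null set, the unordered pair ij is read
   as (i, j) with i < j; any other choice gives an a.e. equal T_F^{a,b} W. *)
Definition induced_density (k : nat) (F : lgraph k)
    (W : Omega * Omega -> R) (x : 'I_k -> Omega) : R :=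
  (\prod_(ij : 'I_k * 'I_k | (ij.1 < ij.2)%N && edge F ij.1 ij.2)
     W (x ij.1, x ij.2)) *
  (\prod_(ij : 'I_k * 'I_k | (ij.1 < ij.2)%N && ~~ edge F ij.1 ij.2)
     (1 - W (x ij.1, x ij.2))).

(* The base point is only relevant at a and b: all the other coordinates are
   integrated out. *)
Definition rooted_density (k : nat) (F : lgraph k) (a b : 'I_k)
    (W : Omega * Omega -> R) (z : Omega * Omega) : R :=
  coord_integral [seq i <- enum 'I_k | (i != a) && (i != b)]
    (induced_density F W) (fun i => if i == a then z.1 else z.2).

Definition velocity (k : nat) (rule : lgraph k -> lgraph k -> R)
    (W : Omega * Omega -> R) (z : Omega * Omega) : R :=
  \sum_(F : lgraph k) \sum_(H : lgraph k) rule F H *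
    \sum_(ab : 'I_k * 'I_k | ab.1 != ab.2)
      rooted_density F ab.1 ab.2 W z *
      ((edge H ab.1 ab.2 && ~~ edge F ab.1 ab.2)%:R -
       (edge F ab.1 ab.2 && ~~ edge H ab.1 ab.2)%:R).

Definition has_Linfty_derivative (Phi : R -> Omega * Omega -> R) (t : R)
    (V : Omega * Omega -> R) : Prop :=
  Lnorm (P \x P)%E +oo%E
    (fun z => (h^-1 * (Phi (t + h) z - Phi t z) - V z)%:E) @[h --> 0^'] --> 0%E.

Definition is_solution (k : nat) (rule : lgraph k -> lgraph k -> R)
    (W : Omega * Omega -> R) (D : set R) (Phi : R -> Omega * Omega -> R) :
    Prop :=
  [/\ [/\ open D, is_interval D & D 0],
      forall t, D t -> is_kernel (Phi t),
      \forall z \ae (P \x P)%E, Phi 0 z = W z &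
      forall t, D t -> has_Linfty_derivative Phi t (velocity rule (Phi t))].

(* A trajectory t |-> Phi^t W with domain D = D_W; the values of Phi outside
   D are irrelevant. *)
Definition is_maximal_solution (k : nat) (rule : lgraph k -> lgraph k -> R)
    (W : Omega * Omega -> R) (D : set R) (Phi : R -> Omega * Omega -> R) :
    Prop :=
  is_solution rule W D Phi /\
  forall (D' : set R) (Psi : R -> Omega * Omega -> R),
    is_solution rule W D' Psi -> D `<=` D' ->
    (forall t, D t -> \forall z \ae (P \x P)%E, Psi t z = Phi t z) ->
    D' = D.

Definition graphon_times (D : set R) (Phi : R -> Omega * Omega -> R) : set R :=
  [set t | D t /\ is_graphon (Phi t)].

End probability_space.

Definition C_square (k : nat) : nat := ((k * (k - 1)) ^ 2 * 2 ^ 'C(k, 2))%N.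

(* Main.v *)
(* The velocity field is Lipschitz for the cut norm on [0,1]-valued kernels: the
   difference of two induced densities telescopes over the pairs of vertices,
   and once all variables but [x_i], [x_j] are fixed, the other factors of a term
   with [(U - W) (x_i, x_j)] split as [f (x_i) * g (x_j)] with [f], [g] valued in
   [0,1], against which [U - W] integrates to at most its cut norm. Gronwall's
   inequality then concludes, provided both trajectories consist of graphons
   between times 0 and [t]. This holds because graphons are preserved forward
   in time: at a graphon the velocity lies between [- N W] and [N (1 - W)], so
   the [L^oo] distance of a trajectory to the [0,1]-valued kernels grows at a
   rate at most proportional to itself. When [t < 0] this is applied from time
   [t] to time 0. *)

Require Import Defs.
From HB Require Import structures.
From mathcomp Require Import all_boot all_order all_algebra.
From mathcomp Require Import all_classical all_reals all_analysis.
From mathcomp Require Import measurable_realfun ess_sup_inf ring lra.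

Set Implicit Arguments.
Unset Strict Implicit.
Unset Printing Implicit Defensive.
Import Order.TTheory GRing.Theory Num.Theory.
Import numFieldNormedType.Exports.
Local Open Scope classical_set_scope.
Local Open Scope ring_scope.

(** * Bounded measurable functions *)

Section bounded_measurable.
Context d (T : measurableType d) (R : realType).
Implicit Types f g : T -> R.

(** The cut norm need not be differentiable along a trajectory, so Gronwall's inequality is run on
    increments: over a short time [h] each trajectory follows its velocity up to an error [e * h],
    and only bounds of the form [at most r] are propagated. Kernels matter up to null sets, whereas
    the estimates on densities are pointwise. Values of trajectories are therefore replaced by
    clamped representatives, and the velocity has to be shown to respect a.e. equality. This takes
    Fubini, because a density evaluates the kernel at pairs of coordinates that are partly
    integrated out. [C_square] counts the graphs [F] ([2 ^ 'C(k, 2)]), the ordered roots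
    ([k * (k - 1)]) and the telescoped pairs (at most [k * (k - 1)]). The sum over the target graph
    [H] costs nothing, as each row of the rule sums to 1. Functions are bounded everywhere rather
    than a.e., so that all their sections and pullbacks are bounded too, and integrable without
    exceptional points. *)

Definition bmeas f := measurable_fun setT f /\ exists M : R, forall x, `|f x| <= M.

Lemma bmeas_cst (c : R) : bmeas (fun=> c).
Proof. by split => //; exists `|c|. Qed.

Lemma bmeasD f g : bmeas f -> bmeas g -> bmeas (fun x => f x + g x).
Proof.
move=> [mf [M fM]] [mg [N gN]]; split; first exact: measurable_funD.
by exists (M + N) => x; rewrite (le_trans (ler_normD _ _))// lerD.
Qed.

Lemma bmeasM f g : bmeas f -> bmeas g -> bmeas (fun x => f x * g x).
Proof.
move=> [mf [M fM]] [mg [N gN]]; split; first exact: measurable_funM.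
by exists (M * N) => x; rewrite normrM ler_pM.
Qed.

Lemma bmeasN f : bmeas f -> bmeas (fun x => - f x).
Proof.
move=> [mf [M fM]]; split; first exact: measurable_funN.
by exists M => x; rewrite normrN.
Qed.

Lemma bmeasB f g : bmeas f -> bmeas g -> bmeas (fun x => f x - g x).
Proof. by move=> bf bg; exact: bmeasD bf (bmeasN bg). Qed.

Lemma bmeas_norm f : bmeas f -> bmeas (fun x => `|f x|).
Proof.
move=> [mf [M fM]]; split; first exact: measurableT_comp.
by exists M => x; rewrite normr_id.
Qed.

Lemma bmeas_sum (I : Type) (s : seq I) (p : pred I) (F : I -> T -> R) :
  (forall i, p i -> bmeas (F i)) -> bmeas (fun x => \sum_(i <- s | p i) F i x).
Proof.
move=> bF; elim: s => [|i s ih].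
  by under eq_fun do rewrite big_nil; exact: bmeas_cst.
under eq_fun do rewrite big_cons.
by case pi : (p i) => //; apply: bmeasD => //; exact: bF.
Qed.

Lemma bmeas_indic (A : set T) : measurable A -> bmeas (\1_A).
Proof.
move=> mA; split; first exact: measurable_indic.
by exists 1 => x; rewrite indicE; case: (x \in A); rewrite ?normr1 ?normr0.
Qed.

Lemma bmeas_clamp f (a b : R) : measurable_fun setT f -> a <= b ->
  bmeas (fun x => Num.max a (Num.min b (f x))).
Proof.
move=> mf ab; split.
  by apply: measurable_maxr => //; exact: measurable_minr.
exists (Num.max `|a| `|b|) => x; rewrite ler_norml; apply/andP; split.
  rewrite le_max lerNl le_max -normrN ler_norm orTb orTb//.
by rewrite ge_max !le_max ler_norm/= !ge_min (ler_norm b) !orbT.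
Qed.

End bounded_measurable.

Lemma bmeas_comp d d' (T : measurableType d) (T' : measurableType d')
    (R : realType) (f : T' -> R) (g : T -> T') :
  bmeas f -> measurable_fun setT g -> bmeas (fun x => f (g x)).
Proof.
move=> [mf [M fM]] mg; split; first exact: measurableT_comp.
by exists M => x.
Qed.

Section bounded_integral.
Context d (T : measurableType d) (R : realType) (P : probability T R).
Implicit Types f g : T -> R.

Lemma bmeas_integrable f : bmeas f -> P.-integrable setT (EFin \o f).
Proof.
move=> [mf [M fM]]; apply: measurable_bounded_integrable => //.
  by rewrite -ge0_fin_numE// fin_num_measure.
by exists M; split; [exact: num_real|move=> y My x _; exact: le_trans (fM x) (ltW My)].
Qed.

Lemma bintegralD f g : bmeas f -> bmeas g ->
  \int[P]_x (f x + g x) = \int[P]_x f x + \int[P]_x g x.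
Proof. by move=> bf bg; rewrite RintegralD//; exact: bmeas_integrable. Qed.

Lemma bintegralB f g : bmeas f -> bmeas g ->
  \int[P]_x (f x - g x) = \int[P]_x f x - \int[P]_x g x.
Proof. by move=> bf bg; rewrite RintegralB//; exact: bmeas_integrable. Qed.

Lemma bintegralZl f (c : R) : bmeas f ->
  \int[P]_x (c * f x) = c * \int[P]_x f x.
Proof. by move=> bf; rewrite RintegralZl//; exact: bmeas_integrable. Qed.

Lemma bintegralN f : bmeas f -> \int[P]_x (- f x) = - \int[P]_x f x.
Proof.
move=> bf; rewrite -[RHS]mulN1r -bintegralZl//.
by apply: eq_Rintegral => x _; rewrite mulN1r.
Qed.

Lemma bintegral_cst (c : R) : \int[P]_x c = c.
Proof.
by rewrite Rintegral_cst// [X in fine X](@probability_setT _ _ _ P) mulr1.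
Qed.

Lemma le_bintegral f g : bmeas f -> bmeas g -> (forall x, f x <= g x) ->
  \int[P]_x f x <= \int[P]_x g x.
Proof. by move=> bf bg fg; apply: le_Rintegral => //; exact: bmeas_integrable. Qed.

Lemma normr_bintegral f : bmeas f -> `|\int[P]_x f x| <= \int[P]_x `|f x|.
Proof. by move=> bf; apply: le_normr_Rintegral => //; exact: bmeas_integrable. Qed.

Lemma normr_bintegral_le f (M : R) : bmeas f -> (forall x, `|f x| <= M) ->
  `|\int[P]_x f x| <= M.
Proof.
move=> bf fM; apply: le_trans (normr_bintegral bf) _.
rewrite -[leRHS]bintegral_cst; apply: le_bintegral => //.
- exact: bmeas_norm.
- exact: bmeas_cst.
Qed.

Lemma bintegral_sum (I : Type) (s : seq I) (p : pred I) (F : I -> T -> R) :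
  (forall i, p i -> bmeas (F i)) ->
  \int[P]_x (\sum_(i <- s | p i) F i x) = \sum_(i <- s | p i) \int[P]_x F i x.
Proof.
move=> bF; elim: s => [|i s ih].
  under eq_Rintegral do rewrite big_nil.
  by rewrite bintegral_cst big_nil.
under eq_Rintegral do rewrite big_cons.
rewrite big_cons; case: ifPn => // pi.
by rewrite bintegralD ?ih//; [exact: bF|exact: bmeas_sum].
Qed.

Lemma bintegral_ae_eq f g : bmeas f -> bmeas g ->
  (\forall x \ae P, f x = g x) -> \int[P]_x f x = \int[P]_x g x.
Proof.
move=> [mf _] [mg _] fg; congr fine; apply: ae_eq_integral => //.
- exact/measurable_EFinP.
- exact/measurable_EFinP.
- by apply: filterS fg => x /= -> .
Qed.

Lemma bintegral_eq0 f : bmeas f -> (forall x, 0 <= f x) ->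
  \int[P]_x f x = 0 -> \forall x \ae P, f x = 0.
Proof.
move=> bf f0 If0; have [mf _] := bf.
have : (\int[P]_x `|(f x)%:E| = 0)%E.
  under eq_integral do rewrite gee0_abs ?lee_fin//.
  rewrite -[LHS]fineK; first by rewrite [X in X%:E]If0.
  exact/(integrable_fin_num _ (bmeas_integrable bf)).
move=> /ae_eq_integral_abs -/(_ measurableT) H.
have /H : measurable_fun setT (EFin \o f) by exact/measurable_EFinP.
by apply: filterS => x /= /(_ I) [].
Qed.

End bounded_integral.

(** * Fubini's theorem for bounded measurable functions *)

Section bounded_fubini.
Context d1 d2 (T1 : measurableType d1) (T2 : measurableType d2) (R : realType).
Variables (P1 : probability T1 R) (P2 : probability T2 R).
Implicit Types f : T1 * T2 -> R.

Let integrable_prod f : bmeas f ->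
  (P1 \x P2)%E.-integrable setT (EFin \o f).
Proof.
exact: (@bmeas_integrable _ _ _ ((P1 \x P2)%E : probability (T1 * T2)%type R)).
Qed.

Lemma bfubini1 f : bmeas f ->
  \int[(P1 \x P2)%E]_z f z = \int[P1]_x \int[P2]_y f (x, y).
Proof.
move=> bf; rewrite /Rintegral -integral12_prod_meas1; last exact: integrable_prod.
congr fine; apply: eq_integral => x _; rewrite /fubini_F/= fineK//.
apply: integrable_fin_num => //.
exact: (bmeas_integrable P2 (bmeas_comp bf (pair1_measurable x))).
Qed.

Lemma bfubini f : bmeas f ->
  \int[P1]_x \int[P2]_y f (x, y) = \int[P2]_y \int[P1]_x f (x, y).
Proof.
move=> bf; rewrite -bfubini1// /Rintegral -integral21_prod_meas1; last exact: integrable_prod.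
congr fine; apply: eq_integral => y _; rewrite /fubini_G/= fineK//.
apply: integrable_fin_num => //.
exact: (bmeas_integrable P1 (bmeas_comp bf (pair2_measurable y))).
Qed.

Lemma iterated_bintegralN f : bmeas f ->
  \int[P1]_x \int[P2]_y (- f (x, y)) = - \int[P1]_x \int[P2]_y f (x, y).
Proof.
move=> bf; rewrite -(bfubini1 (bmeasN bf)) -bfubini1//.
exact: (bintegralN ((P1 \x P2)%E : probability (T1 * T2)%type R)).
Qed.

End bounded_fubini.

Lemma bmeas_integral d1 d2 (T1 : measurableType d1) (T2 : measurableType d2)
    (R : realType) (P2 : probability T2 R) (f : T1 * T2 -> R) :
  bmeas f -> bmeas (fun x => \int[P2]_y f (x, y)).
Proof.
move=> bf; have [mf [M fM]] := bf.
have bfx x : bmeas (fun y => f (x, y)) by exact: bmeas_comp bf (pair1_measurable x).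
split; last by exists M => x; apply: normr_bintegral_le.
(* Tonelli's measurability result is about nonnegative functions: the integrand is shifted by its
   bound [M], which is subtracted afterwards. *)
have mh : measurable_fun setT (fubini_F P2 (fun z => (f z + M)%:E)).
  apply: measurable_fun_fubini_tonelli_F.
    by apply/measurable_EFinP; exact: measurable_funD.
  move=> z; rewrite lee_fin -lerBlDr sub0r.
  by have := fM z; rewrite ler_norml => /andP[].
have -> : (fun x => \int[P2]_y f (x, y)) =
    (fun x => fine (fubini_F P2 (fun z => (f z + M)%:E) x) - M).
  apply/funext => x; rewrite /fubini_F -/(Rintegral _ _ _).
  rewrite (@bintegralD _ _ _ P2 (fun y => f (x, y)) (fun=> M))//.
    by rewrite bintegral_cst addrK.
  exact: bmeas_cst.
apply: measurable_funB => //.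
by apply: measurableT_comp => //; exact: fine_measurable.
Qed.

(** * Iterated integrals over coordinates *)

Section cylinder_functions.
Context d (Omega : measurableType d) (R : realType) (P : probability Omega R).
Variable k : nat.
Local Notation conf := ('I_k -> Omega).
Implicit Types (f g : conf -> R) (x y : conf) (i j : 'I_k) (s t : seq 'I_k).

(* Measurability on [Omega ^ k] is tested on measurable families of points, so
   that no sigma-algebra on the function space is needed. *)
Definition good f :=
  (exists M : R, forall x, `|f x| <= M) /\
  forall d' (T : measurableType d') (phi : T -> conf),
    (forall i, measurable_fun setT (phi ^~ i)) -> measurable_fun setT (f \o phi).

Lemma good_bmeas f d' (T : measurableType d') (phi : T -> conf) : good f ->
  (forall i, measurable_fun setT (phi ^~ i)) -> bmeas (fun u => f (phi u)).
Proof. by move=> [[M fM] mf] mphi; split; [exact: mf|exists M]. Qed.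

Lemma goodP f (M : R) : (forall x, `|f x| <= M) ->
  (forall d' (T : measurableType d') (phi : T -> conf),
    (forall i, measurable_fun setT (phi ^~ i)) -> bmeas (fun u => f (phi u))) ->
  good f.
Proof. by move=> fM bf; split=> [|d' T phi /bf[]//]; exists M. Qed.

Lemma good_cst (c : R) : good (fun=> c).
Proof. by apply: (@goodP _ `|c|) => // d' T phi _; exact: bmeas_cst. Qed.

Lemma goodM f g : good f -> good g -> good (fun x => f x * g x).
Proof.
move=> gf gg; have [[M fM] _] := gf; have [[N gN] _] := gg.
apply: (@goodP _ (M * N)) => [x|d' T phi mphi]; first by rewrite normrM ler_pM.
by apply: bmeasM; exact: good_bmeas.
Qed.

Lemma goodB f g : good f -> good g -> good (fun x => f x - g x).
Proof.
move=> gf gg; have [[M fM] _] := gf; have [[N gN] _] := gg.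
apply: (@goodP _ (M + N)) => [x|d' T phi mphi].
  by rewrite (le_trans (ler_normB _ _))// lerD.
by apply: bmeasB; exact: good_bmeas.
Qed.

Lemma goodD f g : good f -> good g -> good (fun x => f x + g x).
Proof.
move=> gf gg; have [[M fM] _] := gf; have [[N gN] _] := gg.
apply: (@goodP _ (M + N)) => [x|d' T phi mphi].
  by rewrite (le_trans (ler_normD _ _))// lerD.
by apply: bmeasD; exact: good_bmeas.
Qed.

Lemma good_norm f : good f -> good (fun x => `|f x|).
Proof.
move=> gf; have [[M fM] _] := gf.
apply: (@goodP _ M) => [x|d' T phi mphi]; first by rewrite normr_id.
by apply: bmeas_norm; exact: good_bmeas.
Qed.

Lemma good_sum (I : Type) (r : seq I) (p : pred I) (F : I -> conf -> R) :
  (forall l, p l -> good (F l)) -> good (fun x => \sum_(l <- r | p l) F l x).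
Proof.
move=> gF; elim: r => [|l r ih].
  by under eq_fun do rewrite big_nil; exact: good_cst.
under eq_fun do rewrite big_cons.
by case pl : (p l) => //; apply: goodD => //; exact: gF.
Qed.

Lemma good_prod (I : Type) (r : seq I) (p : pred I) (F : I -> conf -> R) :
  (forall l, p l -> good (F l)) -> good (fun x => \prod_(l <- r | p l) F l x).
Proof.
move=> gF; elim: r => [|l r ih].
  by under eq_fun do rewrite big_nil; exact: good_cst.
under eq_fun do rewrite big_cons.
by case pl : (p l) => //; apply: goodM => //; exact: gF.
Qed.

Lemma good_pair (W : Omega * Omega -> R) i j : bmeas W ->
  good (fun x => W (x i, x j)).
Proof.
move=> bW; have [_ [M WM]] := bW.
apply: (@goodP _ M) => // d' T phi mphi.
apply: (bmeas_comp bW (g := fun u => (phi u i, phi u j))).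
exact: measurable_fun_pair.
Qed.

Definition upd x i (u : Omega) : conf := [eta x with i |-> u].

Lemma updE x i u j : upd x i u j = if j == i then u else x j.
Proof. by []. Qed.

Lemma measurable_upd d' (T : measurableType d') (phi : T -> conf)
    (h : T -> Omega) i : (forall j, measurable_fun setT (phi ^~ j)) ->
  measurable_fun setT h ->
  forall j, measurable_fun setT (fun u => upd (phi u) i (h u) j).
Proof. move=> mphi mh j; under eq_fun do rewrite updE.
by case: (j == i); [exact: mh|exact: mphi]. Qed.

Lemma bmeas_upd f x i : good f -> bmeas (fun u => f (upd x i u)).
Proof.
move=> gf; apply: (good_bmeas (phi := fun u => upd x i u)) => // j.
exact: (@measurable_upd _ _ (fun=> x) id).
Qed.

(** The integrand is tested on the enlarged parameter space [T * Omega]; this is why [good]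
    quantifies over all measurable parameter spaces. *)
Lemma good_integral f i : good f -> good (fun x => \int[P]_u f (upd x i u)).
Proof.
move=> gf; have [[M fM] _] := gf.
apply: (@goodP _ M) => [x|d' T phi mphi].
  by apply: normr_bintegral_le => // ; exact: bmeas_upd.
apply: (bmeas_integral P (f := fun z => f (upd (phi z.1) i z.2))).
apply: (good_bmeas (phi := fun z : T * Omega => upd (phi z.1) i z.2)) => //.
apply: measurable_upd => //.
by move=> j; apply: (measurableT_comp (f := phi ^~ j)).
Qed.

Lemma good_coord_integral s f : good f -> good (coord_integral P s f).
Proof. by move=> gf; elim: s => //= i s ih; exact: good_integral. Qed.

Lemma coord_integral_cat s t f :
  coord_integral P (s ++ t) f = coord_integral P s (coord_integral P t f).
Proof.
elim: s => //= i s ih; apply/funext => x.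
by apply: eq_Rintegral => u _; rewrite ih.
Qed.

Lemma le_coord_integral s f g x : good f -> good g -> (forall y, f y <= g y) ->
  coord_integral P s f x <= coord_integral P s g x.
Proof.
move=> gf gg fg; elim: s x => //= i s ih x.
apply: le_bintegral => [||u]; last exact: ih.
- exact/bmeas_upd/good_coord_integral.
- exact/bmeas_upd/good_coord_integral.
Qed.

Lemma coord_integralB s f g x : good f -> good g ->
  coord_integral P s (fun y => f y - g y) x =
  coord_integral P s f x - coord_integral P s g x.
Proof.
move=> gf gg; elim: s x => //= i s ih x.
rewrite -bintegralB; first by apply: eq_Rintegral => u _; rewrite ih.
- exact/bmeas_upd/good_coord_integral.
- exact/bmeas_upd/good_coord_integral.
Qed.

Lemma coord_integral_sum (I : Type) (r : seq I) (F : I -> conf -> R) s x :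
  (forall l, good (F l)) ->
  coord_integral P s (fun y => \sum_(l <- r) F l y) x =
  \sum_(l <- r) coord_integral P s (F l) x.
Proof.
move=> gF; elim: s x => //= i s ih x.
rewrite -bintegral_sum; first by apply: eq_Rintegral => u _; rewrite ih.
by move=> l _; exact/bmeas_upd/good_coord_integral.
Qed.

Definition free s (h : conf -> R) := forall i x u, i \in s -> h (upd x i u) = h x.

Lemma coord_integralMl s f h x : good f -> free s h ->
  coord_integral P s (fun y => h y * f y) x = h x * coord_integral P s f x.
Proof.
move=> gf; elim: s x => //= i s ih x fh.
rewrite -bintegralZl; last exact/bmeas_upd/good_coord_integral.
apply: eq_Rintegral => u _; rewrite ih; last first.
  by move=> j y v js; apply: fh; rewrite in_cons js orbT.
by rewrite -/(upd _ _ _) fh// mem_head.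
Qed.

Lemma coord_integral_cst s (c : R) x : coord_integral P s (fun=> c) x = c.
Proof.
elim: s x => //= i s ih x.
by under eq_Rintegral do rewrite ih; exact: bintegral_cst.
Qed.

Lemma coord_integral_free s h x : free s h -> coord_integral P s h x = h x.
Proof.
move=> fh; rewrite -[RHS]mulr1 -(coord_integral_cst s 1 x) -coord_integralMl//.
  by congr coord_integral; apply/funext => y; rewrite mulr1.
exact: good_cst.
Qed.

Lemma normr_coord_integral_le s f (c : R) x : good f ->
  (forall y, `|f y| <= c) -> `|coord_integral P s f x| <= c.
Proof.
move=> gf fc; elim: s x => //= i s ih x.
by apply: normr_bintegral_le => [|u]; [exact/bmeas_upd/good_coord_integral|exact: ih].
Qed.

Lemma normr_coord_integral s f x : good f ->
  `|coord_integral P s f x| <= coord_integral P s (fun y => `|f y|) x.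
Proof.
move=> gf; elim: s x => //= i s ih x.
have bsf : bmeas (fun u => coord_integral P s f (upd x i u)).
  exact/bmeas_upd/good_coord_integral.
apply: le_trans (normr_bintegral P bsf) _; apply: le_bintegral => [||u].
- exact: bmeas_norm.
- exact/bmeas_upd/good_coord_integral/good_norm.
- exact: ih.
Qed.

Lemma coord_integral_agree s f x y : (forall i, i \notin s -> x i = y i) ->
  coord_integral P s f x = coord_integral P s f y.
Proof.
elim: s x y => /= [x y xy|i s ih x y xy].
  by congr f; apply/funext => i; exact: xy.
apply: eq_Rintegral => u _; apply: ih => j js.
rewrite -!/(upd _ _ _) !updE; case: ifPn => // ji.
by apply: xy; rewrite in_cons negb_or ji.
Qed.

Lemma updC x i j u v : i != j -> upd (upd x i u) j v = upd (upd x j v) i u.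
Proof.
move=> ij; apply/funext => l; rewrite !updE.
by case: (eqVneq l j) => // ->; rewrite eq_sym (negbTE ij).
Qed.

Lemma coord_integral_swap i j s f x : good f ->
  coord_integral P (i :: j :: s) f x = coord_integral P (j :: i :: s) f x.
Proof.
move=> gf; have [->//|ij] := eqVneq i j.
rewrite /= (bfubini P P (f := fun z =>
  coord_integral P s f (upd (upd x i z.1) j z.2))).
  apply: eq_Rintegral => v _; apply: eq_Rintegral => u _ /=.
  by rewrite -!/(upd _ _ _) updC.
apply: (good_bmeas (phi := fun z : Omega * Omega => upd (upd x i z.1) j z.2)).
  exact: good_coord_integral.
by apply: measurable_upd => //; apply: measurable_upd.
Qed.

(** Fubini exchanges two adjacent coordinates; hence one coordinate moves across a block, then two
    blocks are exchanged, and block exchanges generate all permutations. *)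
Lemma coord_integral_perm s t f x : good f -> perm_eq s t ->
  coord_integral P s f x = coord_integral P t f x.
Proof.
move=> gf st; apply/esym; move: s t st.
have swap1 i s t y :
    coord_integral P (i :: s ++ t) f y = coord_integral P (s ++ i :: t) f y.
  elim: s y => // j s ih y; rewrite cat_cons coord_integral_swap// cat_cons.
  by apply: eq_Rintegral => u _; exact: ih.
have swap2 s1 s2 s3 y : coord_integral P (s1 ++ s2 ++ s3) f y =
    coord_integral P (s2 ++ s1 ++ s3) f y.
  elim: s1 s2 y => // i s1 ih s2 y.
  rewrite cat_cons -swap1; apply: eq_Rintegral => u _; exact: ih.
move=> s t st; pose Q t' := coord_integral P t' f x = coord_integral P s f x.
suff: Q t by [].
by apply: (catCA_perm_ind _ st) => // s1 s2 s3; rewrite /Q swap2.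
Qed.

End cylinder_functions.

(** * Cut norm *)

Section cut_bound.
Context d (Omega : measurableType d) (R : realType) (P : probability Omega R).
Implicit Types (D U W : Omega * Omega -> R) (A B : set Omega) (f g : Omega -> R).

(** A bound on all rectangles stands in for the supremum: it is monotone and closed in [c], hence
    fit for Gronwall's inequality, and sums of such bounds need no side condition on [sup]. *)
Definition cut_le D (c : R) := forall A B, measurable A -> measurable B ->
  `|\int[(P \x P)%E]_(z in A `*` B) D z| <= c.

Lemma integral_rectangle D A B : bmeas D -> measurable A -> measurable B ->
  \int[(P \x P)%E]_(z in A `*` B) D z =
  \int[P]_u \int[P]_v (D (u, v) * (\1_A u * \1_B v)).
Proof.
move=> bD mA mB; rewrite Rintegral_mkcond.
rewrite -(bfubini1 P P (f := fun z => D z * (\1_A z.1 * \1_B z.2))).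
  apply: eq_Rintegral => -[u v] _ /=; rewrite patchE in_setX/= !indicE.
  by case: (u \in A); case: (v \in B); rewrite /= ?(mulr1, mulr0, mul0r).
apply: bmeasM => //; apply: bmeasM.
- by apply: (bmeas_comp (bmeas_indic R mA)).
- by apply: (bmeas_comp (bmeas_indic R mB)).
Qed.

Lemma cut_leN D (c : R) : bmeas D -> cut_le D c -> cut_le (fun z => - D z) c.
Proof.
move=> bD Dc A B mA mB; rewrite integral_rectangle//; last exact: bmeasN.
have bAB : bmeas (fun z : Omega * Omega => D z * (\1_A z.1 * \1_B z.2 : R)).
  apply: bmeasM => //; apply: bmeasM.
  - by apply: (bmeas_comp (bmeas_indic R mA)).
  - by apply: (bmeas_comp (bmeas_indic R mB)).
have -> : \int[P]_u \int[P]_v (- D (u, v) * (\1_A u * \1_B v)) =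
    \int[P]_u \int[P]_v (- (D (u, v) * (\1_A u * \1_B v))).
  by apply: eq_Rintegral => u _; apply: eq_Rintegral => v _; rewrite mulNr.
rewrite (iterated_bintegralN P P bAB)/= normrN.
by rewrite -integral_rectangle//; exact: Dc.
Qed.

Lemma cut_leBC U W (c : R) : bmeas U -> bmeas W ->
  cut_le (fun z => U z - W z) c -> cut_le (fun z => W z - U z) c.
Proof.
move=> bU bW /(cut_leN (bmeasB bU bW)).
by congr cut_le; apply/funext => z; rewrite opprB.
Qed.

(** A linear functional with density [psi] is largest, among functions valued in [0,1], at the
    indicator of the set where [psi] is nonnegative. *)
Lemma integral_le_indic (f psi : Omega -> R) : bmeas f -> bmeas psi ->
  (forall u, 0 <= f u <= 1) ->
  exists2 A, measurable A &
    \int[P]_u (psi u * f u) <= \int[P]_u (psi u * \1_A u).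
Proof.
move=> bf bpsi f01; pose A := psi @^-1` `[0, +oo[.
have mA : measurable A.
  by rewrite -[A]setTI; have [mpsi _] := bpsi; apply: mpsi.
exists A => //; apply: le_bintegral.
- exact: bmeasM.
- by apply: bmeasM => //; exact: bmeas_indic.
move=> u; rewrite indicE; have /andP[f0 f1] := f01 u.
have [uA|uA] := boolP (u \in A).
  move: uA; rewrite inE /A/= in_itv/= andbT => pu.
  by rewrite mulr1 ler_piMr.
move: uA; rewrite notin_setE /A/= in_itv/= andbT => /negP pu.
by rewrite mulr0 mulr_le0_ge0// ltW// ltNge.
Qed.

(** The double integral is linear in [f] for fixed [g] and conversely, so [f] and then [g] can be
    replaced by indicators without decreasing it. The lower bound is the upper bound for [- D]. *)
Lemma cut_le_weighted D (c : R) f g : bmeas D -> cut_le D c ->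
  bmeas f -> bmeas g -> (forall u, 0 <= f u <= 1) -> (forall v, 0 <= g v <= 1) ->
  `|\int[P]_u \int[P]_v (D (u, v) * (f u * g v))| <= c.
Proof.
move=> bD Dc bf bg f01 g01.
have bw h1 h2 : bmeas h1 -> bmeas h2 ->
    bmeas (fun z : Omega * Omega => h1 z.1 * h2 z.2 : R).
  by move=> b1 b2; apply: bmeasM; [exact: (bmeas_comp b1)|exact: (bmeas_comp b2)].
have bl h : bmeas h -> bmeas (fun z : Omega * Omega => h z.1 : R).
  by move=> b1; exact: (bmeas_comp b1).
have br h : bmeas h -> bmeas (fun z : Omega * Omega => h z.2 : R).
  by move=> b1; exact: (bmeas_comp b1).
have upper E : bmeas E -> cut_le E c ->
    \int[P]_u \int[P]_v (E (u, v) * (f u * g v)) <= c.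
  move=> bE Ec.
  have bEu h u : bmeas h -> bmeas (fun v => E (u, v) * h v).
    by move=> bh; apply: bmeasM => //; apply: (bmeas_comp bE).
  have bEv h v : bmeas h -> bmeas (fun u => E (u, v) * h u).
    by move=> bh; apply: bmeasM => //; apply: (bmeas_comp bE).
  have pull h1 h2 : bmeas h1 -> bmeas h2 ->
      \int[P]_u \int[P]_v (E (u, v) * (h1 u * h2 v)) =
      \int[P]_u ((\int[P]_v (E (u, v) * h2 v)) * h1 u).
    move=> b1 b2; apply: eq_Rintegral => u _; rewrite mulrC -bintegralZl; last exact: bEu.
    by apply: eq_Rintegral => v _; rewrite mulrCA.
  have pull' h1 h2 : bmeas h1 -> bmeas h2 ->
      \int[P]_u \int[P]_v (E (u, v) * (h1 u * h2 v)) =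
      \int[P]_v ((\int[P]_u (E (u, v) * h1 u)) * h2 v).
    move=> b1 b2; rewrite (bfubini P P (f := fun z => E z * (h1 z.1 * h2 z.2))).
      apply: eq_Rintegral => v _; rewrite mulrC -bintegralZl; last exact: bEv.
      by apply: eq_Rintegral => u _ /=; rewrite mulrA mulrC.
    by apply: bmeasM => //; exact: bw.
  have [|A mA lefA] := @integral_le_indic f (fun u => \int[P]_v (E (u, v) * g v)) bf _ f01.
    apply: (bmeas_integral P (f := fun z => E z * g z.2)).
    by apply: bmeasM => //; exact: br.
  rewrite pull// (le_trans lefA)// -pull//; last exact: bmeas_indic.
  have [|B mB legB] := @integral_le_indic g (fun v => \int[P]_u (E (u, v) * \1_A u)) bg _ g01.
    apply: (bmeas_integral P (f := fun z => E (z.2, z.1) * \1_A z.2)).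
    apply: bmeasM; last exact/br/bmeas_indic.
    by apply: (bmeas_comp bE); exact: measurable_fun_pair.
  have bA : bmeas (\1_A : Omega -> R) by exact: bmeas_indic.
  have bB : bmeas (\1_B : Omega -> R) by exact: bmeas_indic.
  rewrite pull'// (le_trans legB)// -pull'//.
  rewrite -integral_rectangle//.
  exact: le_trans (ler_norm _) (Ec _ _ mA mB).
rewrite ler_norml upper// andbT lerNl.
have bfg : bmeas (fun z : Omega * Omega => D z * (f z.1 * g z.2)).
  by apply: bmeasM => //; exact: bw.
rewrite -(iterated_bintegralN P P bfg)/=.
have -> : (\int[P]_u \int[P]_v - (D (u, v) * (f u * g v))) =
    \int[P]_u \int[P]_v (- D (u, v) * (f u * g v)).
  by apply: eq_Rintegral => u _; apply: eq_Rintegral => v _; rewrite mulNr.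
by apply: (upper (fun z => - D z)); [exact: bmeasN|exact: cut_leN].
Qed.

Lemma bmeas_integrable_rectangle D A B : bmeas D -> measurable A -> measurable B ->
  (P \x P)%E.-integrable (A `*` B) (EFin \o D).
Proof.
move=> bD mA mB; apply: (@integrableS _ _ _ _ setT) => //; first exact: measurableX.
exact: (bmeas_integrable ((P \x P)%E : probability (Omega * Omega)%type R)).
Qed.

Lemma cut_le_ge0 D (c : R) : cut_le D c -> 0 <= c.
Proof. by move=> /(_ _ _ measurable0 measurable0); exact: le_trans. Qed.

Lemma cut_leD D D' (c c' : R) : bmeas D -> bmeas D' -> cut_le D c -> cut_le D' c' ->
  cut_le (fun z => D z + D' z) (c + c').
Proof.
move=> bD bD' Dc Dc' A B mA mB.
rewrite RintegralD; [|exact: measurableX|exact: bmeas_integrable_rectangle..].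
by rewrite (le_trans (ler_normD _ _))// lerD ?Dc ?Dc'.
Qed.

Lemma cut_leZ D (a c : R) : bmeas D -> cut_le D c ->
  cut_le (fun z => a * D z) (`|a| * c).
Proof.
move=> bD Dc A B mA mB.
rewrite RintegralZl; [|exact: measurableX|exact: bmeas_integrable_rectangle].
by rewrite normrM ler_wpM2l// Dc.
Qed.

Lemma cut_le_sum (I : Type) (s : seq I) (p : pred I)
    (D : I -> Omega * Omega -> R) (c : I -> R) :
  (forall i, p i -> bmeas (D i)) -> (forall i, p i -> cut_le (D i) (c i)) ->
  cut_le (fun z => \sum_(i <- s | p i) D i z) (\sum_(i <- s | p i) c i).
Proof.
move=> bD Dc; elim: s => [|i s ih].
  move=> A B mA mB; rewrite big_nil.
  under eq_Rintegral do rewrite big_nil.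
  by rewrite Rintegral_cst ?mul0r ?normr0//; exact: measurableX.
rewrite big_cons; under eq_fun do rewrite big_cons.
case pi : (p i) => //; apply: cut_leD => //; [exact: bD|exact: bmeas_sum|exact: Dc].
Qed.

Lemma cut_le_ae D D' (c : R) : bmeas D -> bmeas D' ->
  (\forall z \ae (P \x P)%E, D z = D' z) -> cut_le D c -> cut_le D' c.
Proof.
move=> [mD _] [mD' _] DD' Dc A B mA mB; apply: le_trans (Dc A B mA mB).
rewrite le_eqVlt; apply/orP; left; apply/eqP; congr (`| fine _ |).
apply: ae_eq_integral; first exact: measurableX.
- exact/measurable_EFinP/measurable_funTS.
- exact/measurable_EFinP/measurable_funTS.
- by apply: filterS DD' => z /= ->.
Qed.

End cut_bound.

(** * Induced and rooted densities *)

(** Telescoping one factor at a time; with [1 <= M] the single power [M ^+ size r] dominates all the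
    partial products that appear. *)
Lemma dist_prod_le (R : realType) (I : Type) (r : seq I) (a b : I -> R) (M : R) :
  1 <= M -> (forall i, `|a i| <= M) -> (forall i, `|b i| <= M) ->
  `|\prod_(i <- r) a i - \prod_(i <- r) b i| <=
  M ^+ size r * \sum_(i <- r) `|a i - b i|.
Proof.
move=> M1 aM bM; have M0 : 0 <= M by exact: le_trans M1.
elim: r => [|i r ih]; first by rewrite !big_nil subrr normr0 mulr0.
have bMn : `|\prod_(j <- r) b j| <= M ^+ size r.
  rewrite normr_prod; elim: r {ih} => [|j r ih]; first by rewrite big_nil.
  by rewrite big_cons exprS ler_pM// prodr_ge0.
rewrite !big_cons.
have -> : a i * \prod_(j <- r) a j - b i * \prod_(j <- r) b j =
    a i * (\prod_(j <- r) a j - \prod_(j <- r) b j) +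
    (a i - b i) * \prod_(j <- r) b j by ring.
rewrite (le_trans (ler_normD _ _))// !normrM mulrDr addrC lerD//.
  rewrite mulrC ler_wpM2r// (le_trans bMn)//= exprS ler_peMl// exprn_ge0//.
rewrite exprS -mulrA; apply: ler_pM => //.
Qed.

Section densities.
Context d (Omega : measurableType d) (R : realType) (P : probability Omega R).
Variable k : nat.
Local Notation conf := ('I_k -> Omega).
Implicit Types (U W : Omega * Omega -> R) (F : lgraph k) (x y : conf)
  (q : 'I_k * 'I_k) (s : seq 'I_k).

Definition increasing_pairs : seq ('I_k * 'I_k) :=
  [seq q : 'I_k * 'I_k <- index_enum _ | (q.1 < q.2)%N].

Lemma mem_increasing_pairs q : (q \in increasing_pairs) = (q.1 < q.2)%N.
Proof. by rewrite mem_filter mem_index_enum andbT. Qed.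

Lemma card_offdiag : #|[pred q : 'I_k * 'I_k | q.1 != q.2]| = (k * (k - 1))%N.
Proof.
have := cardC [pred q : 'I_k * 'I_k | q.1 == q.2].
rewrite card_prod card_ord => E; rewrite mulnBr muln1 -E.
have -> : #|[pred q : 'I_k * 'I_k | q.1 == q.2]| = k.
  have inj_diag : injective (fun i : 'I_k => (i, i)) by move=> i j [].
  rewrite -[RHS](card_ord k) -(fintype.card_image inj_diag).
  apply: eq_card => -[i j]; rewrite !inE/=.
  by apply/eqP/fintype.imageP => [->|[l _ [-> ->]]//]; exists j.
by rewrite addKn; apply: eq_card.
Qed.

(** The exact size is ['C(k, 2)]; this cruder bound is the source of one of the two factors
    [k * (k - 1)] in [C_square]. *)
Lemma size_increasing_pairs : (size increasing_pairs <= k * (k - 1))%N.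
Proof.
rewrite -card_offdiag -sum1_size big_filter sum1_card; apply: fintype.subset_leq_card.
apply/fintype.subsetP => q q12; have {q12} : (q.1 < q.2)%N by [].
by rewrite inE => q12; apply: contraTneq q12 => ->; rewrite ltnn.
Qed.

Definition factor F W q x : R :=
  if edge F q.1 q.2 then W (x q.1, x q.2) else 1 - W (x q.1, x q.2).

Lemma induced_densityE F W x :
  induced_density F W x = \prod_(q <- increasing_pairs) factor F W q x.
Proof.
rewrite /increasing_pairs big_filter (bigID (fun q => edge F q.1 q.2))/=.
congr (_ * _); apply: eq_bigr => q /andP[_].
  by rewrite /factor => ->.
by rewrite /factor => /negbTE ->.
Qed.

Lemma good_factor F W q : bmeas W -> good (factor F W q).
Proof.
move=> bW; rewrite /factor; case: (edge F q.1 q.2); first exact: good_pair.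
by apply: goodB; [exact: good_cst|exact: good_pair].
Qed.

Lemma good_induced_density F W : bmeas W -> good (induced_density F W).
Proof.
move=> bW; have -> : induced_density F W =
    fun x => \prod_(q <- increasing_pairs) factor F W q x.
  by apply/funext => x; exact: induced_densityE.
by apply: good_prod => q _; exact: good_factor.
Qed.

Lemma dist_factor F U W q x :
  `|factor F U q x - factor F W q x| = `|U (x q.1, x q.2) - W (x q.1, x q.2)|.
Proof.
rewrite /factor; case: ifP => // _.
by rewrite -normrN; congr `|_|; ring.
Qed.

Lemma factor01 F W q x : (forall z, 0 <= W z <= 1) -> 0 <= factor F W q x <= 1.
Proof.
move=> W01; have /andP[W0 W1] := W01 (x q.1, x q.2).
rewrite /factor; case: ifP => _; first by rewrite W0.
by rewrite subr_ge0 W1 gerBl.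
Qed.

(** [1 + M] bounds both kinds of factors, [W] and [1 - W]. *)
Lemma dist_induced_density F U W (M : R) x : 0 <= M ->
  (forall z, `|U z| <= M) -> (forall z, `|W z| <= M) ->
  `|induced_density F U x - induced_density F W x| <=
  (1 + M) ^+ size increasing_pairs *
    \sum_(q <- increasing_pairs) `|U (x q.1, x q.2) - W (x q.1, x q.2)|.
Proof.
move=> M0 UM WM; rewrite !induced_densityE.
have fM V q : (forall z, `|V z| <= M) -> `|factor F V q x| <= 1 + M.
  move=> VM; rewrite /factor; case: ifP => _.
    by rewrite (le_trans (VM _))// lerDr.
  by rewrite (le_trans (ler_normB _ _))// normr1 lerD.
have M1 : 1 <= 1 + M by rewrite lerDl.
apply: le_trans (dist_prod_le _ M1 (fM U ^~ UM) (fM W ^~ WM)) _.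
by under eq_bigr do rewrite dist_factor.
Qed.

Definition rest (a b : 'I_k) : seq 'I_k :=
  [seq i <- enum 'I_k | (i != a) && (i != b)].

Definition root (a b : 'I_k) (z : Omega * Omega) : conf :=
  fun i => if i == a then z.1 else z.2.

Lemma root_fst (a b : 'I_k) z : root a b z a = z.1.
Proof. by rewrite /root eqxx. Qed.

Lemma root_snd (a b : 'I_k) z : a != b -> root a b z b = z.2.
Proof. by move=> ab; rewrite /root eq_sym (negbTE ab). Qed.

Lemma measurable_root (a b : 'I_k) i : measurable_fun setT (fun z => root a b z i).
Proof.
by rewrite /root; case: (i == a); [exact: measurable_fst|exact: measurable_snd].
Qed.

Lemma bmeas_root (f : conf -> R) (a b : 'I_k) :
  good f -> bmeas (fun z => coord_integral P (rest a b) f (root a b z)).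
Proof.
move=> gf; apply: (good_bmeas (phi := root a b)); first exact: good_coord_integral.
exact: measurable_root.
Qed.

Lemma bmeas_rooted F (a b : 'I_k) W : bmeas W -> bmeas (rooted_density P F a b W).
Proof. by move=> bW; exact/bmeas_root/good_induced_density. Qed.

Lemma perm_all (a b i j : 'I_k) : a != b -> i != j ->
  perm_eq (a :: b :: rest a b) (rest i j ++ [:: i; j]).
Proof.
move=> ab ij; apply: (@perm_trans _ (enum 'I_k)).
  apply: uniq_perm; rewrite ?enum_uniq//=.
    by rewrite inE !mem_filter !eqxx !andbF (negbTE ab)/= filter_uniq ?enum_uniq.
  move=> l; rewrite !inE mem_filter !mem_enum/= andbT.
  by case: eqP => //= _; case: eqP.
apply: uniq_perm; rewrite ?enum_uniq//=.
  rewrite cat_uniq filter_uniq ?enum_uniq//= inE ij/= orbF !mem_filter !eqxx.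
  by rewrite !andbF.
move=> l; rewrite mem_cat !inE mem_enum /rest mem_filter mem_enum/= andbT.
by case: eqP => //= _; case: eqP.
Qed.

(** Once the roots are integrated too, all [k] coordinates play the same part and can be reordered.
    The base point [x0] is arbitrary, each of its coordinates being overwritten. *)
Lemma integral_root (a b : 'I_k) (G : Omega * Omega -> R) (f : conf -> R) x0 :
  a != b -> bmeas G -> good f ->
  \int[(P \x P)%E]_z (G z * coord_integral P (rest a b) f (root a b z)) =
  coord_integral P (a :: b :: rest a b) (fun x => G (x a, x b) * f x) x0.
Proof.
move=> ab bG gf; rewrite bfubini1; last by apply: bmeasM => //; exact: bmeas_root.
apply: eq_Rintegral => u _; apply: eq_Rintegral => v _.
rewrite -!/(upd _ _ _).
rewrite [RHS](coord_integralMl P (h := fun x => G (x a, x b)) _ gf); last first.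
  move=> i x w; rewrite mem_filter => /andP[/andP[ia ib] _].
  by rewrite !updE [a == _]eq_sym [b == _]eq_sym (negbTE ia) (negbTE ib).
rewrite !updE !eqxx (negbTE ab); congr (_ * _).
apply: coord_integral_agree => i; rewrite mem_filter mem_enum andbT negb_and !negbK.
rewrite !updE /root => iab; case: (eqVneq i a) => [->|ia]; first by rewrite (negbTE ab).
by move: iab; rewrite (negbTE ia)/= => ->.
Qed.

Lemma coord_integral_pair (i j : 'I_k) (D : Omega * Omega -> R) (f : conf -> R) x :
  i != j -> coord_integral P [:: i; j] (fun y => D (y i, y j) * f y) x =
  \int[P]_u \int[P]_v (D (u, v) * f (upd (upd x i u) j v)).
Proof.
move=> ij; apply: eq_Rintegral => u _; apply: eq_Rintegral => v _ /=.
by rewrite !eqxx (negbTE ij).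
Qed.

(** A nonnegative function with zero integral vanishes a.e. Integrating over the roots as well gives
    an integral over all coordinates; with those of [q] moved innermost, the inner integral of [D]
    is already 0. *)
Lemma coord_integral_ae0 (a b : 'I_k) q (D : Omega * Omega -> R) :
  a != b -> q.1 != q.2 -> bmeas D -> (forall z, 0 <= D z) ->
  (\forall z \ae (P \x P)%E, D z = 0) ->
  \forall z \ae (P \x P)%E,
    coord_integral P (rest a b) (fun x => D (x q.1, x q.2)) (root a b z) = 0.
Proof.
move=> ab q12 bD D0 Dae; pose PP := ((P \x P)%E : probability (Omega * Omega)%type R).
have gD : good (fun x => D (x q.1, x q.2)) by exact: good_pair.
apply: (@bintegral_eq0 _ _ _ PP); first exact: bmeas_root.
  move=> z; rewrite -(coord_integral_cst P (rest a b) 0 (root a b z)).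
  by apply: le_coord_integral => //; exact: good_cst.
transitivity (\int[(P \x P)%E]_z (1 *
    coord_integral P (rest a b) (fun x => D (x q.1, x q.2)) (root a b z))).
  by apply: eq_Rintegral => z _; rewrite mul1r.
rewrite (integral_root (G := fun=> 1) (fun=> point))//; last exact: bmeas_cst.
rewrite (coord_integral_perm P _ _ (perm_all ab q12)); last first.
  by apply: goodM => //; exact: good_cst.
rewrite coord_integral_cat -[RHS](coord_integral_cst P (rest q.1 q.2) 0 (fun=> point)).
congr coord_integral; apply/funext => x.
have -> : (fun y : conf => 1 * D (y q.1, y q.2)) = (fun y => D (y q.1, y q.2) * 1).
  by apply/funext => y; rewrite mulrC.
rewrite (coord_integral_pair _ (fun=> 1))//.
rewrite -(bfubini1 P P (f := fun z => D z * 1)); last first.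
  by apply: bmeasM => //; exact: bmeas_cst.
rewrite -[RHS](bintegral_cst PP 0); apply: (bintegral_ae_eq (P := PP)).
- by apply: bmeasM => //; exact: bmeas_cst.
- exact: bmeas_cst.
- by apply: filterS Dae => z ->; rewrite mul0r.
Qed.

Lemma dist_rooted_density F (a b : 'I_k) U W (M : R) z : 0 <= M ->
  bmeas U -> bmeas W -> (forall z, `|U z| <= M) -> (forall z, `|W z| <= M) ->
  `|rooted_density P F a b U z - rooted_density P F a b W z| <=
  (1 + M) ^+ size increasing_pairs * \sum_(q <- increasing_pairs)
    coord_integral P (rest a b) (fun x => `|U (x q.1, x q.2) - W (x q.1, x q.2)|)
      (root a b z).
Proof.
move=> M0 bU bW UM WM.
have gU := good_induced_density F bU; have gW := good_induced_density F bW.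
have gq q : good (fun x => `|U (x q.1, x q.2) - W (x q.1, x q.2)|).
  by apply/good_norm/goodB; exact: good_pair.
rewrite /rooted_density -/(rest a b) -/(root a b z) -coord_integralB//.
rewrite -coord_integral_sum//.
rewrite -(coord_integralMl P (h := fun=> (1 + M) ^+ size increasing_pairs))//; last first.
  by apply: good_sum => q _; exact: gq.
have gR : good (fun y : conf => (1 + M) ^+ size increasing_pairs *
    \sum_(q <- increasing_pairs) `|U (y q.1, y q.2) - W (y q.1, y q.2)|).
  by apply: goodM; [exact: good_cst|apply: good_sum => q _; exact: gq].
apply: le_trans (normr_coord_integral P _ _ (goodB gU gW)) _.
apply: le_coord_integral => [||x] //; first exact/good_norm/goodB.
exact: dist_induced_density.
Qed.

End densities.

(** * Lipschitz bound for rooted densities in the cut norm *)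

Section cut_norm_lipschitz.
Context d (Omega : measurableType d) (R : realType) (P : probability Omega R).
Variable k : nat.
Local Notation conf := ('I_k -> Omega).
Implicit Types (U W : Omega * Omega -> R) (F : lgraph k) (x y : conf)
  (q : 'I_k * 'I_k) (G H : conf -> R).

Definition split_along q G := forall x, exists f g : Omega -> R,
  [/\ bmeas f /\ bmeas g, forall u, 0 <= f u <= 1, forall v, 0 <= g v <= 1 &
      forall u v, G (upd (upd x q.1 u) q.2 v) = f u * g v].

Lemma split_along1 q : split_along q (fun=> 1).
Proof.
move=> x; exists (fun=> 1), (fun=> 1); split => //; try by rewrite ler01 lexx.
- by split; exact: bmeas_cst.
- by move=> u v; rewrite mulr1.
Qed.

Lemma split_alongM q G H : split_along q G -> split_along q H ->
  split_along q (fun x => G x * H x).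
Proof.
have in01M (s t : R) : 0 <= s <= 1 -> 0 <= t <= 1 -> 0 <= s * t <= 1.
  by move=> /andP[s0 s1] /andP[t0 t1]; rewrite mulr_ge0//= mulr_ile1.
move=> sG sH x; have [f [g [[bf bg] f01 g01 Gfg]]] := sG x.
have [f' [g' [[bf' bg'] f'01 g'01 Hfg]]] := sH x.
exists (fun u => f u * f' u), (fun v => g v * g' v); split.
- by split; exact: bmeasM.
- by move=> u; exact: in01M.
- by move=> v; exact: in01M.
- by move=> u v; rewrite Gfg Hfg mulrACA.
Qed.

Lemma split_along_prod (I : eqType) (r : seq I) q (G : I -> conf -> R) :
  (forall i, i \in r -> split_along q (G i)) ->
  split_along q (fun x => \prod_(i <- r) G i x).
Proof.
elim: r => [|i r ih] sG.
  by under eq_fun do rewrite big_nil; exact: split_along1.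
under eq_fun do rewrite big_cons.
have sr : split_along q (fun x => \prod_(j <- r) G j x).
  by apply ih => j jr; apply sG; rewrite in_cons jr orbT.
exact (split_alongM (sG i (mem_head i r)) sr).
Qed.

(** If one endpoint of [q] has no influence, [G] is a function of the other endpoint times the
    constant 1. *)
Lemma split_along_free q G : q.1 != q.2 -> good G -> (forall x, 0 <= G x <= 1) ->
  free [:: q.1] G \/ free [:: q.2] G -> split_along q G.
Proof.
move=> q12 gG G01 [fG|fG] x.
- exists (fun=> 1), (fun v => G (upd x q.2 v)); split => //.
  + by split; [exact: bmeas_cst|exact: bmeas_upd].
  + by move=> _; rewrite ler01 lexx.
  + by move=> u v; rewrite updC// fG ?mem_head// mul1r.
- exists (fun u => G (upd x q.1 u)), (fun=> 1); split => //.
  + by split; [exact: bmeas_upd|exact: bmeas_cst].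
  + by move=> _; rewrite ler01 lexx.
  + by move=> u v; rewrite fG ?mem_head// mulr1.
Qed.

Lemma split_along_coord q (f : Omega -> R) (a : 'I_k) : q.1 != q.2 -> bmeas f ->
  (forall u, 0 <= f u <= 1) -> split_along q (fun x => f (x a)).
Proof.
move=> q12 bf f01; refine (split_along_free _ _ _ _) => //.
  by apply: (good_pair (W := fun z => f z.1) a a); exact: (bmeas_comp bf).
have [qa|qa] := eqVneq q.1 a.
  right=> i x u; rewrite inE => /eqP ->; rewrite updE.
  by rewrite -qa (negbTE q12).
left=> i x u; rewrite inE => /eqP ->; rewrite updE.
by rewrite eq_sym (negbTE qa).
Qed.

(* Two distinct pairs share at most one vertex, so the factor of one of them
   depends on at most one of the coordinates of the other. *)
Lemma split_along_factor F W q q' : bmeas W -> (forall z, 0 <= W z <= 1) ->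
  (q.1 < q.2)%N -> (q'.1 < q'.2)%N -> q != q' -> split_along q (factor F W q').
Proof.
move=> bW W01 q12 q12' qq'; refine (split_along_free _ _ _ _).
- by apply: contraTneq q12 => ->; rewrite ltnn.
- exact: good_factor.
- by move=> x; exact: factor01.
have freeP i : i != q'.1 -> i != q'.2 -> free [:: i] (factor F W q').
  move=> i1 i2 j x u; rewrite inE => /eqP ->; rewrite /factor !updE.
  by rewrite eq_sym (negbTE i1) eq_sym (negbTE i2).
have [q11|q11] := eqVneq q.1 q'.1.
  right; apply: freeP.
    by apply: contraTneq q12 => ->; rewrite q11 ltnn.
  apply: contra qq' => /eqP q22; apply/eqP.
  by rewrite (surjective_pairing q) (surjective_pairing q') q11 q22.
have [q1'|q1'] := eqVneq q.1 q'.2; last by left; exact: freeP.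
right; apply: freeP.
  apply: contraTneq q12 => ->; rewrite q1' -leqNgt; exact: ltnW.
by apply: contraTneq q12 => ->; rewrite q1' ltnn.
Qed.

(** All coordinates being integrated, those of [q] can be moved innermost. The inner double integral
    is at most [c] in absolute value for any value of the others, and averaging over a probability
    preserves this. *)
Lemma cut_one_factor F U W (c : R) (a b : 'I_k) q G x0 : a != b ->
  (q.1 < q.2)%N -> bmeas U -> bmeas W -> cut_le P (fun z => U z - W z) c ->
  good G -> split_along q G ->
  `|coord_integral P (a :: b :: rest a b)
      (fun x => (factor F U q x - factor F W q x) * G x) x0| <= c.
Proof.
move=> ab q12 bU bW UWc gG sG.
have q12' : q.1 != q.2 by apply: contraTneq q12 => ->; rewrite ltnn.
have gUW : good (fun x => (factor F U q x - factor F W q x) * G x).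
  by apply: goodM => //; apply: goodB; exact: good_factor.
rewrite (coord_integral_perm P _ gUW (perm_all ab q12')) coord_integral_cat.
apply: normr_coord_integral_le; first exact: good_coord_integral.
move=> x; have [f [g [[bf bg] f01 g01 Gfg]]] := sG x.
have bUW : bmeas (fun z => U z - W z) by exact: bmeasB.
have key := cut_le_weighted bUW UWc bf bg f01 g01.
rewrite /factor; case: (edge F q.1 q.2).
  rewrite (coord_integral_pair P (fun z => U z - W z) G x q12').
  by under eq_Rintegral do under eq_Rintegral do rewrite Gfg.
(* For a non-edge the difference of the factors [1 - U] and [1 - W] is [W - U], hence the change of
   sign. *)
rewrite (_ : (fun x => _) = fun x => (W (x q.1, x q.2) - U (x q.1, x q.2)) * G x); last first.
  by apply/funext => y; congr (_ * _); ring.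
rewrite (coord_integral_pair P (fun z => W z - U z) G x q12').
have bH : bmeas (fun z : Omega * Omega => (U z - W z) * (f z.1 * g z.2)).
  by apply: bmeasM => //; apply: bmeasM; [exact: (bmeas_comp bf)|exact: (bmeas_comp bg)].
have <- : (\int[P]_u \int[P]_v - ((U (u, v) - W (u, v)) * (f u * g v))) =
    \int[P]_u \int[P]_v ((W (u, v) - U (u, v)) * G (upd (upd x q.1 u) q.2 v)).
  by apply: eq_Rintegral => u _; apply: eq_Rintegral => v _; rewrite Gfg; ring.
by rewrite (iterated_bintegralN P P bH)/= normrN; exact: key.
Qed.

(** Each pair of [r] costs one [c]. The weight [G] is generalized because it collects the factors of
    [U] already passed; as [r] has no repetition, these split along every pair still to come. *)
Lemma cut_product F U W (c : R) (a b : 'I_k) (r : seq ('I_k * 'I_k)) G x0 :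
  a != b -> bmeas U -> bmeas W ->
  (forall z, 0 <= U z <= 1) -> (forall z, 0 <= W z <= 1) ->
  cut_le P (fun z => U z - W z) c ->
  uniq r -> (forall q, q \in r -> (q.1 < q.2)%N) ->
  good G -> (forall q, q \in r -> split_along q G) ->
  `|coord_integral P (a :: b :: rest a b) (fun x => G x *
      (\prod_(q <- r) factor F U q x - \prod_(q <- r) factor F W q x)) x0| <=
  (size r)%:R * c.
Proof.
move=> ab bU bW U01 W01 UWc; elim: r G => [|q r ih] G.
  move=> _ _ gG _; rewrite mul0r.
  apply: normr_coord_integral_le => [|y]; last by rewrite !big_nil subrr mulr0 normr0.
  apply: goodM => //; apply: goodB; apply: good_prod => q _; exact: good_factor.
rewrite cons_uniq => /andP[qr ur] r12 gG sG.
have r12' q' : q' \in r -> (q'.1 < q'.2)%N by move=> q'r; apply: r12; rewrite in_cons q'r orbT.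
have q12 : (q.1 < q.2)%N by apply: r12; rewrite mem_head.
have gW q' V : bmeas V -> good (factor F V q') by exact: good_factor.
have gP V : bmeas V -> good (fun x => \prod_(q' <- r) factor F V q' x).
  by move=> bV; apply: good_prod => q' _; exact: gW.
have gG1 : good (fun x => G x * factor F U q x) by apply: goodM => //; exact: gW.
have gG2 : good (fun x => G x * \prod_(q' <- r) factor F W q' x).
  by apply: goodM => //; exact: gP.
(* The head factor passes from [U] to [W] while the tail carries [W]; the tail passes from [U] to
   [W] while the head carries [U] and joins the weight. *)
have -> : (fun x => G x * (\prod_(q' <- q :: r) factor F U q' x -
      \prod_(q' <- q :: r) factor F W q' x)) =
    (fun x => (G x * factor F U q x) *
      (\prod_(q' <- r) factor F U q' x - \prod_(q' <- r) factor F W q' x) -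
      (factor F W q x - factor F U q x) * (G x * \prod_(q' <- r) factor F W q' x)).
  by apply/funext => x; rewrite !big_cons; ring.
rewrite coord_integralB; first last.
- by apply: goodM => //; apply: goodB; exact: gW.
- by apply: goodM => //; apply: goodB; exact: gP.
rewrite (le_trans (ler_normB _ _))//= -natr1 mulrDl mul1r lerD//.
  apply: ih => // q' q'r; refine (split_alongM _ _).
    by refine (sG _ _); rewrite in_cons q'r orbT.
  by refine (split_along_factor _ _ _ _ _ _) => //; [exact: r12'|apply: contraNneq qr => <-].
apply: (@cut_one_factor F W U c a b q (fun x => G x * \prod_(q' <- r) factor F W q' x)) => //.
- exact: cut_leBC.
- refine (split_alongM _ _); first exact: (sG _ (mem_head _ _)).
  refine (split_along_prod _) => q' q'r.
  refine (split_along_factor _ _ _ _ _ _) => //; first exact: r12'.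
  by apply: contraNneq qr => ->.
Qed.

(** The test rectangle enters as the initial weight [\1_A (x a) * \1_B (x b)]: each indicator
    depends on one vertex only, so it splits along every pair, including the pair of the roots. *)
Lemma cut_rooted_density F U W (c : R) (a b : 'I_k) : a != b ->
  bmeas U -> bmeas W -> (forall z, 0 <= U z <= 1) -> (forall z, 0 <= W z <= 1) ->
  cut_le P (fun z => U z - W z) c ->
  cut_le P (fun z => rooted_density P F a b U z - rooted_density P F a b W z)
    ((size (increasing_pairs k))%:R * c).
Proof.
move=> ab bU bW U01 W01 UWc A B mA mB.
have gU := good_induced_density F bU; have gW := good_induced_density F bW.
have bAB : bmeas (fun z : Omega * Omega => \1_A z.1 * \1_B z.2 : R).
  by apply: bmeasM; [exact: (bmeas_comp (bmeas_indic R mA))|exact: (bmeas_comp (bmeas_indic R mB))].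
have bD : bmeas (fun z => rooted_density P F a b U z - rooted_density P F a b W z).
  by apply: bmeasB; exact: bmeas_rooted.
rewrite integral_rectangle//.
rewrite -(bfubini1 P P (f := fun z => (rooted_density P F a b U z -
  rooted_density P F a b W z) * (\1_A z.1 * \1_B z.2))); last exact: bmeasM.
have -> : \int[(P \x P)%E]_z ((rooted_density P F a b U z -
      rooted_density P F a b W z) * (\1_A z.1 * \1_B z.2)) =
    \int[(P \x P)%E]_z ((\1_A z.1 * \1_B z.2) * coord_integral P (rest a b)
      (fun x => induced_density F U x - induced_density F W x) (root a b z)).
  by apply: eq_Rintegral => z _; rewrite coord_integralB// mulrC.
rewrite (integral_root P (fun=> point) ab bAB); last exact: goodB.
have := @cut_product F U W c a b (increasing_pairs k)
  (fun x => \1_A (x a) * \1_B (x b)) (fun=> point) ab bU bW U01 W01 UWc.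
under [X in coord_integral _ _ X]eq_fun do rewrite -!induced_densityE.
have ind01 E : measurable E -> forall u : Omega, 0 <= (\1_E u : R) <= 1.
  by move=> _ u; rewrite indicE; case: (u \in E); rewrite /= ?lexx ?ler01.
apply.
- by rewrite filter_uniq// index_enum_uniq.
- by move=> q; rewrite mem_increasing_pairs.
- exact: (good_pair (W := fun z => \1_A z.1 * \1_B z.2)).
- move=> q; rewrite mem_increasing_pairs => q12.
  have q12' : q.1 != q.2 by apply: contraTneq q12 => ->; rewrite ltnn.
  refine (split_alongM _ _); refine (split_along_coord _ _ _ _) => //; try exact: bmeas_indic.
  + exact: ind01.
  + exact: ind01.
Qed.

End cut_norm_lipschitz.

(** * The velocity field *)

Lemma card_lgraph (k : nat) : #|{: lgraph k}| = (2 ^ 'C(k, 2))%N.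
Proof.
rewrite card_sig -[in RHS](card_ord k) -card_draws -card_powerset.
apply: eq_card => E; rewrite !inE; apply/forall_inP/fintype.subsetP => [h e /h|h e /h].
  by rewrite inE.
by rewrite inE.
Qed.

Lemma edgeC (k : nat) (F : lgraph k) (i j : 'I_k) : edge F i j = edge F j i.
Proof. by rewrite /edge finset.setUC. Qed.

Section velocity_field.
Context d (Omega : measurableType d) (R : realType) (P : probability Omega R).
Variables (k : nat) (rule : lgraph k -> lgraph k -> R).
Hypothesis rule_ok : is_rule rule.
Local Notation V := (velocity P rule).
Implicit Types (U W : Omega * Omega -> R) (F : lgraph k).

Definition drift F (ab : 'I_k * 'I_k) : R := \sum_(H : lgraph k) rule F H *
  ((edge H ab.1 ab.2 && ~~ edge F ab.1 ab.2)%:R -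
   (edge F ab.1 ab.2 && ~~ edge H ab.1 ab.2)%:R).

Lemma velocityE W z : V W z = \sum_(F : lgraph k)
  \sum_(ab : 'I_k * 'I_k | ab.1 != ab.2)
    drift F ab * rooted_density P F ab.1 ab.2 W z.
Proof.
apply: eq_bigr => F _; under eq_bigr do rewrite mulr_sumr.
rewrite exchange_big/=; apply: eq_bigr => ab _; rewrite /drift mulr_suml.
by apply: eq_bigr => H _; ring.
Qed.

Lemma drift_edge F ab : edge F ab.1 ab.2 -> -1 <= drift F ab <= 0.
Proof.
have [r01 r1] := rule_ok; move=> Fab.
have E : drift F ab = - \sum_H rule F H * (~~ edge H ab.1 ab.2)%:R.
  rewrite /drift -sumrN; apply: eq_bigr => H _.
  by rewrite Fab andbF/= sub0r mulrN.
rewrite E oppr_le0 lerN2; apply/andP; split.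
  rewrite -[leRHS](r1 F); apply: ler_sum => H _; have /andP[r0 _] := r01 F H.
  by rewrite ler_piMr// lern1 leq_b1.
by apply: sumr_ge0 => H _; rewrite mulr_ge0//; have /andP[] := r01 F H.
Qed.

Lemma drift_nonedge F ab : ~~ edge F ab.1 ab.2 -> 0 <= drift F ab <= 1.
Proof.
have [r01 r1] := rule_ok; move=> /negbTE Fab.
have -> : drift F ab = \sum_H rule F H * (edge H ab.1 ab.2)%:R.
  by apply: eq_bigr => H _; rewrite Fab andbT/= subr0.
apply/andP; split.
  by apply: sumr_ge0 => H _; rewrite mulr_ge0//; have /andP[] := r01 F H.
rewrite -[leRHS](r1 F); apply: ler_sum => H _; have /andP[r0 _] := r01 F H.
by rewrite ler_piMr// lern1 leq_b1.
Qed.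

Lemma normr_drift F ab : `|drift F ab| <= 1.
Proof.
rewrite ler_norml; have [/drift_edge|/drift_nonedge] := boolP (edge F ab.1 ab.2).
  by move=> /andP[-> d0]; rewrite (le_trans d0).
by move=> /andP[d0 ->]; rewrite andbT (le_trans _ d0)// oppr_le0.
Qed.

Lemma bmeas_velocity W : bmeas W -> bmeas (V W).
Proof.
move=> bW; have -> : V W = fun z => \sum_(F : lgraph k)
    \sum_(ab : 'I_k * 'I_k | ab.1 != ab.2)
      drift F ab * rooted_density P F ab.1 ab.2 W z.
  by apply/funext => z; exact: velocityE.
apply: bmeas_sum => F _; apply: bmeas_sum => ab _.
by apply: bmeasM; [exact: bmeas_cst|exact: bmeas_rooted].
Qed.

(** This allows a trajectory to be replaced by a clamped representative inside the velocity. By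
    [coord_integral_ae0], the bound on the difference of rooted densities vanishes for almost all
    roots. *)
Lemma velocity_ae U W : bmeas U -> bmeas W ->
  (\forall z \ae (P \x P)%E, U z = W z) ->
  \forall z \ae (P \x P)%E, V U z = V W z.
Proof.
move=> bU bW UW; have [_ [M UM]] := bU; have [_ [N WN]] := bW.
have UW0 q (ab : 'I_k * 'I_k) : ab.1 != ab.2 -> q \in increasing_pairs k ->
    \forall z \ae (P \x P)%E, coord_integral P (rest ab.1 ab.2)
      (fun x => `|U (x q.1, x q.2) - W (x q.1, x q.2)|) (root ab.1 ab.2 z) = 0.
  move=> ab12; rewrite mem_increasing_pairs => q12.
  apply: (coord_integral_ae0 (D := fun z => `|U z - W z|)) => //.
  - by apply: contraTneq q12 => ->; rewrite ltnn.
  - exact/bmeas_norm/bmeasB.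
  - by apply: filterS UW => z ->; rewrite subrr normr0.
(* Finitely many roots and pairs occur, so one null set serves them all. *)
have UW0' : \forall z \ae (P \x P)%E, forall p : ('I_k * 'I_k) * ('I_k * 'I_k),
    p.1.1 != p.1.2 -> p.2 \in increasing_pairs k ->
    coord_integral P (rest p.1.1 p.1.2)
      (fun x => `|U (x p.2.1, x p.2.2) - W (x p.2.1, x p.2.2)|)
      (root p.1.1 p.1.2 z) = 0.
  apply: filter_forall => -[ab q] /=.
  have [ab12|ab12] := boolP (ab.1 != ab.2); last by apply: nearW.
  have [qp|qp] := boolP (q \in increasing_pairs k); last by apply: nearW.
  by apply: filterS (UW0 q ab ab12 qp) => z.
apply: filterS UW0' => z z0; rewrite !velocityE.
apply: eq_bigr => F _; apply: eq_bigr => ab ab12; congr (_ * _).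
apply/eqP; rewrite -subr_eq0 -normr_le0.
have M0 : 0 <= Num.max M N.
  by rewrite le_max (le_trans _ (UM point)).
apply: le_trans (dist_rooted_density P F _ _ _ M0 bU bW _ _) _.
- by move=> y; rewrite le_max UM.
- by move=> y; rewrite le_max WN orbT.
rewrite big_seq big1 ?mulr0// => q qp; exact: (z0 (ab, q)).
Qed.

(** The number of pairs ([F], [ab]), written as a double sum so as to be compared with [velocityE]
    term by term. *)
Definition num_terms : R :=
  \sum_(F : lgraph k) \sum_(ab : 'I_k * 'I_k | ab.1 != ab.2) 1.

Lemma num_termsE : num_terms = (2 ^ 'C(k, 2) * (k * (k - 1)))%:R.
Proof.
rewrite /num_terms; under eq_bigr do rewrite sumr_const card_offdiag.
by rewrite sumr_const cardT -cardE card_lgraph -mulrnA mulnC.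
Qed.

Lemma num_terms_ge0 : 0 <= num_terms.
Proof. by rewrite num_termsE. Qed.

Lemma num_termsM (c : R) : num_terms * c =
  \sum_(F : lgraph k) \sum_(ab : 'I_k * 'I_k | ab.1 != ab.2) c.
Proof.
rewrite mulr_suml; apply: eq_bigr => F _; rewrite mulr_suml.
by apply: eq_bigr => ab _; rewrite mul1r.
Qed.

(** The velocity is polynomial in the kernel, hence Lipschitz on balls of the sup norm, with a
    constant that depends on the radius [M]. *)
Lemma velocity_lipschitz (M : R) : 0 <= M -> exists2 L : R, 0 <= L &
  forall U W (r : R), bmeas U -> bmeas W ->
  (forall z, `|U z| <= M) -> (forall z, `|W z| <= M) ->
  (forall z, `|U z - W z| <= r) -> forall z, `|V U z - V W z| <= L * r.
Proof.
move=> M0; pose n := size (increasing_pairs k).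
exists (num_terms * ((1 + M) ^+ n * n%:R)).
  by rewrite mulr_ge0 ?num_terms_ge0// mulr_ge0// exprn_ge0// addr_ge0.
move=> U W r bU bW UM WM UWr z.
rewrite -mulrA num_termsM !velocityE -sumrB.
apply: le_trans (ler_norm_sum _ _ _) _; apply: ler_sum => F _.
rewrite -sumrB; apply: le_trans (ler_norm_sum _ _ _) _; apply: ler_sum => ab _.
rewrite -mulrBr normrM -[leRHS]mul1r; apply: ler_pM => //; first exact: normr_drift.
apply: le_trans (dist_rooted_density P F _ _ _ M0 bU bW UM WM) _.
rewrite -mulrA ler_wpM2l ?exprn_ge0 ?addr_ge0//.
rewrite /n -sum1_size natr_sum mulr_suml; apply: ler_sum => q _.
rewrite mul1r; apply: le_trans (ler_norm _) _; apply: normr_coord_integral_le => [|x].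
  by apply/good_norm/goodB; exact: good_pair.
by rewrite normr_id.
Qed.

(** The factor of the root pair involves no integrated coordinate and comes out of the integral; the
    others lie in [0,1]. Symmetry at [z] is used when [b < a], the pair then being read as
    [(b, a)]. *)
Lemma rooted_density_le (F : lgraph k) (a b : 'I_k) W z : a != b -> bmeas W ->
  (forall z, 0 <= W z <= 1) -> W (z.1, z.2) = W (z.2, z.1) ->
  0 <= rooted_density P F a b W z <= (if edge F a b then W z else 1 - W z).
Proof.
move=> ab bW W01 Wz.
have gF := good_induced_density F bW.
have ge0_prod (r : seq ('I_k * 'I_k)) x : 0 <= \prod_(q <- r) factor F W q x.
  by apply: prodr_ge0 => q _; have /andP[] := factor01 F q x W01.
apply/andP; split.
  rewrite -(coord_integral_cst P (rest a b) 0 (root a b z)).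
  apply: le_coord_integral => //; first exact: good_cst.
  by move=> x; rewrite induced_densityE.
pose q : 'I_k * 'I_k := if (a < b)%N then (a, b) else (b, a).
have q12 : (q.1 < q.2)%N.
  rewrite /q; case: ifPn => //=; rewrite -leqNgt leq_eqVlt => /orP[/eqP/val_inj ba|//].
  by rewrite ba eqxx in ab.
have -> : (if edge F a b then W z else 1 - W z) = factor F W q (root a b z).
  rewrite /factor /q; case: (a < b)%N; rewrite /fst /snd root_fst root_snd//.
    by rewrite -surjective_pairing.
  by rewrite edgeC -Wz -surjective_pairing.
rewrite -(coord_integral_free P (s := rest a b)).
  apply: le_coord_integral => //; first exact: good_factor.
  move=> x; rewrite induced_densityE (big_rem q) ?mem_increasing_pairs//=.
  have /andP[f0 f1] := factor01 F q x W01.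
  rewrite ler_piMr//; elim: (rem _ _) => [|q' r ih]; first by rewrite big_nil.
  by rewrite big_cons mulr_ile1//; have /andP[] := factor01 F q' x W01.
move=> i x u; rewrite mem_filter => /andP[/andP[ia ib] _].
have [E|E] : (q.1 = a /\ q.2 = b) \/ (q.1 = b /\ q.2 = a).
- by rewrite /q; case: ifP => _; [left|right].
- by rewrite /factor !updE E.1 E.2 [a == _]eq_sym [b == _]eq_sym (negbTE ia) (negbTE ib).
- by rewrite /factor !updE E.1 E.2 [a == _]eq_sym [b == _]eq_sym (negbTE ia) (negbTE ib).
Qed.

(* A term of the velocity that decreases [W] carries a factor [W], and a term
   that increases it carries a factor [1 - W]. *)
Lemma velocity_inward W z : bmeas W -> (forall z, 0 <= W z <= 1) ->
  W (z.1, z.2) = W (z.2, z.1) ->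
  - (num_terms * W z) <= V W z <= num_terms * (1 - W z).
Proof.
move=> bW W01 Wz; have /andP[W0 W1] := W01 z.
have W1' : 0 <= 1 - W z by rewrite subr_ge0.
rewrite velocityE -mulrN !num_termsM; apply/andP; split;
  apply: ler_sum => F _; apply: ler_sum => ab ab12;
  have := rooted_density_le F ab12 bW W01 Wz;
  have [/drift_edge|/drift_nonedge] := boolP (edge F ab.1 ab.2);
  move=> /andP[d0 d1] /andP[t0 t1]; nra.
Qed.

(** At most [num_terms] differences of rooted densities occur, each with a coefficient of absolute
    value at most 1 and a cut bound of at most [k * (k - 1)] times [c]; the product of the counts is
    [C_square]. *)
Lemma cut_velocity U W (c : R) : bmeas U -> bmeas W ->
  (forall z, 0 <= U z <= 1) -> (forall z, 0 <= W z <= 1) ->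
  cut_le P (fun z => U z - W z) c ->
  cut_le P (fun z => V U z - V W z) ((C_square k)%:R * c).
Proof.
move=> bU bW U01 W01 UWc; have c0 := cut_le_ge0 UWc.
have -> : (fun z => V U z - V W z) = fun z => \sum_(F : lgraph k)
    \sum_(ab : 'I_k * 'I_k | ab.1 != ab.2) drift F ab *
    (rooted_density P F ab.1 ab.2 U z - rooted_density P F ab.1 ab.2 W z).
  apply/funext => z; rewrite !velocityE -sumrB; apply: eq_bigr => F _.
  by rewrite -sumrB; apply: eq_bigr => ab _; rewrite mulrBr.
have bD F (ab : 'I_k * 'I_k) : bmeas (fun z =>
    rooted_density P F ab.1 ab.2 U z - rooted_density P F ab.1 ab.2 W z).
  by apply: bmeasB; exact: bmeas_rooted.
have bdD F (ab : 'I_k * 'I_k) : bmeas (fun z => drift F ab *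
    (rooted_density P F ab.1 ab.2 U z - rooted_density P F ab.1 ab.2 W z)).
  by apply: bmeasM => //; exact: bmeas_cst.
move=> A B mA mB.
apply: (@le_trans _ _ (\sum_(F : lgraph k) \sum_(ab : 'I_k * 'I_k | ab.1 != ab.2)
    (`|drift F ab| * ((size (increasing_pairs k))%:R * c)))).
  apply: cut_le_sum => // [F _|F _]; first exact: bmeas_sum.
  apply: cut_le_sum => // ab ab12; apply: cut_leZ => //.
  exact: cut_rooted_density.
apply: (@le_trans _ _ (num_terms * ((k * (k - 1))%:R * c))).
  rewrite num_termsM; apply: ler_sum => F _; apply: ler_sum => ab _.
  rewrite -[leRHS]mul1r; apply: ler_pM => //; first by rewrite mulr_ge0.
    exact: normr_drift.
  by rewrite ler_wpM2r// ler_nat size_increasing_pairs.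
rewrite num_termsE mulrA -natrM ler_wpM2r// ler_nat /C_square.
by rewrite [leqRHS]mulnC -mulnA.
Qed.

End velocity_field.

(** * Gronwall's inequality *)

(* Gronwall's inequality in the form [Q t r] = "the quantity at time [t] is at
   most [r]", so that it applies to essential suprema without naming them; the
   estimate of the right increments is only needed as long as [r <= M]. *)
Lemma gronwall_growth (R : realType) (Q : R -> R -> Prop) (a b L eta c M : R) :
  0 <= L -> 0 < eta -> 0 < c -> a <= b ->
  c * expR ((L + eta) * (b - a)) <= M ->
  (forall t r r', r <= r' -> Q t r -> Q t r') ->
  (forall t r, a <= t <= b -> (forall e, 0 < e -> Q t (r + e)) -> Q t r) ->
  Q a c ->
  (forall t, a < t <= b -> forall e, 0 < e -> exists2 dl, 0 < dl &
    forall h r, 0 < h < dl -> a <= t - h -> Q (t - h) r -> Q t (r + e)) ->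
  (forall t, a <= t < b -> forall r, 0 < r <= M -> Q t r ->
    forall e, 0 < e -> exists2 dl, 0 < dl &
    forall h, 0 < h < dl -> t + h <= b -> Q (t + h) (r * (1 + L * h) + e * h)) ->
  Q b (c * expR ((L + eta) * (b - a))).
Proof.
move=> L0 eta0 c0 ab cM Qmono Qclosed Qa Qleft Qright.
pose beta t := c * expR ((L + eta) * (t - a)).
have k0 : 0 < L + eta by rewrite ltr_wpDl.
have beta_mono s t : s <= t -> beta s <= beta t.
  by move=> st; rewrite ler_pM2l// ler_expR ler_pM2l// lerB.
have beta0 t : 0 < beta t by rewrite mulr_gt0// expR_gt0.
pose S := [set t | a <= t <= b /\ forall s, a <= s <= t -> Q s (beta s)].
have Sa : S a.
  split; first by rewrite lexx ab.
  move=> s; rewrite -eq_le => /eqP <-.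
  by rewrite /beta subrr mulr0 expR0 mulr1.
have Sb : ubound S b by move=> t [/andP[]].
have S0 : S !=set0 by exists a.
pose m := sup S.
have am : a <= m by apply: ub_le_sup => //; exists b.
have mb : m <= b by exact: ge_sup.
(* The supremum is attained: the bound holds before [m], control from the left gives it at [m] up to
   any [e], and closedness removes [e]. *)
have Sm : S m.
  have below s : a <= s < m -> Q s (beta s).
    move=> /andP[as_ sm]; have [t St st] := sup_gt S0 sm.
    by have [_] := St; apply; rewrite as_ ltW.
  split; first by rewrite am mb.
  move=> s /andP[as_]; rewrite le_eqVlt => /orP[/eqP ->|sm]; last first.
    by apply: below; rewrite as_ sm.
  have [<-|am'] := eqVneq a m.
    by rewrite /beta subrr mulr0 expR0 mulr1.
  have {}am' : a < m by rewrite lt_neqAle am' am.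
  apply: Qclosed => [|e e0]; first by rewrite am mb.
  have [|dl dl0 Hdl] := Qleft m _ e e0; first by rewrite am' mb.
  pose h := Num.min dl (m - a) / 2.
  have h0 : 0 < h by rewrite divr_gt0// lt_min dl0 subr_gt0.
  have hmin : h < Num.min dl (m - a) by rewrite ltr_pdivrMr// ltr_pMr ?ltr1n// lt_min dl0 subr_gt0.
  have /andP[hdl hma] : (h < dl) && (h < m - a) by rewrite -lt_min.
  have amh : a <= m - h by rewrite lerBrDl -lerBrDr ltW.
  apply: (Qmono _ (beta (m - h) + e)).
    by rewrite lerD2r beta_mono// gerBl ltW.
  apply: (Hdl h) => //; first by rewrite h0 hdl.
  by apply: below; rewrite amh ltrBlDr ltrDl.
have [mE|mb'] := eqVneq m b.
  by have [_] := Sm; rewrite mE; apply; rewrite ab lexx.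
have {}mb' : m < b by rewrite lt_neqAle mb' mb.
have Qm : Q m (beta m) by have [_] := Sm; apply; rewrite am lexx.
(* The error rate [eta * beta m] spends the slack [eta]: the next bound is
   [beta m * (1 + (L + eta) * h)], which is below [beta (m + h)] by [1 + x <= expR x]. Hence [m < b]
   would contradict the choice of [m]. *)
have [|||dl dl0 Hdl] := Qright m _ (beta m) _ Qm (eta * beta m).
- by rewrite am mb'.
- by rewrite beta0/= (le_trans (beta_mono _ _ mb)).
- by rewrite mulr_gt0.
pose h := Num.min dl (b - m) / 2.
have h0 : 0 < h by rewrite divr_gt0// lt_min dl0 subr_gt0.
have hmin : h < Num.min dl (b - m) by rewrite ltr_pdivrMr// ltr_pMr ?ltr1n// lt_min dl0 subr_gt0.
have /andP[hdl hbm] : (h < dl) && (h < b - m) by rewrite -lt_min.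
have Smh : S (m + h).
  split; first by rewrite (le_trans am) ?lerDl ?(ltW h0)//= -lerBrDl ltW.
  move=> s /andP[as_ smh]; have [sm|ms] := leP s m.
    by have [_] := Sm; apply; rewrite as_ sm.
  have h'0 : 0 < s - m by rewrite subr_gt0.
  have h'dl : s - m < dl by rewrite (le_lt_trans _ hdl)// lerBlDl.
  have sb : s <= b by rewrite (le_trans smh)// -lerBrDl ltW.
  have := Hdl (s - m); rewrite h'0 h'dl subrKC => /(_ isT sb).
  apply: Qmono.
  have -> : beta s = beta m * expR ((L + eta) * (s - m)).
    by rewrite /beta -mulrA -expRD -mulrDr; congr (_ * expR (_ * _)); ring.
  have -> : beta m * (1 + L * (s - m)) + eta * beta m * (s - m) =
      beta m * (1 + (L + eta) * (s - m)) by ring.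
  by rewrite ler_pM2l// expR_ge1Dx.
have : m + h <= m by apply: ub_le_sup => //; exists b.
by rewrite gerDl leNgt h0.
Qed.

(** * Trajectories *)

Section flow.
Context d (Omega : measurableType d) (R : realType) (P : probability Omega R).
Local Notation PP := (P \x P)%E.
Implicit Types (W E D : Omega * Omega -> R).

(** The null set may depend on [h]. This suffices, since every later use concerns one fixed time
    step. *)
Lemma Linfty_derivative_increment (Phi : R -> Omega * Omega -> R) (t : R)
    (V : Omega * Omega -> R) (e : R) : has_Linfty_derivative P Phi t V -> 0 < e ->
  exists2 dl : R, 0 < dl & forall h : R, h != 0 -> `|h| < dl ->
    \forall z \ae PP, `|Phi (t + h) z - (Phi t z + h * V z)| <= e * `|h|.
Proof.
move=> dPhi e0.
(* The norm of exponent [+oo] unfolds to an essential supremum only when the whole space has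
   positive measure. *)
have PPT : (0 < PP setT)%E.
  by rewrite [X in (_ < X)%E](@probability_setT _ _ _ (PP : probability (Omega * Omega)%type R)).
have : nbhs (0 : \bar R)%E [set y | (y < e%:E)%E].
  by apply: open_nbhs_nbhs; split; [exact: open_ereal_lt_ereal|rewrite /= lte_fin].
move=> /dPhi /nbhs_ballP [dl /= dl0 Hdl]; exists dl => // h h0 hdl.
have := Hdl h; rewrite /ball/= sub0r normrN => /(_ hdl h0).
rewrite Lnorm.unlock PPT => /ltW /ess_supP.
apply: filterS => z /=; rewrite lee_fin => Hz.
have -> : Phi (t + h) z - (Phi t z + h * V z) =
    h * (h^-1 * (Phi (t + h) z - Phi t z) - V z).
  by rewrite mulrBr mulrA divff// mul1r opprD addrA.
by rewrite normrM mulrC ler_wpM2r.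
Qed.

Lemma kernel_bmeas W : is_kernel P W -> bmeas W.
Proof.
move=> [mW bW _]; split => //; have [M [_ WM]] := bW.
by exists (M + 1) => z; apply: (WM (M + 1)) => //; rewrite ltrDl.
Qed.

(** Truncation to [[-r, 1 + r]]: it turns an a.e. range into one valid at every point, and
    [clamp 0 W] is a [0,1]-valued kernel close to [W]. *)
Definition clamp (r : R) W z := Num.max (- r) (Num.min (1 + r) (W z)).

Lemma bmeas_clampW (r : R) W : 0 <= r -> bmeas W -> bmeas (clamp r W).
Proof.
move=> r0 [mW _]; apply: bmeas_clamp => //.
by rewrite (@le_trans _ _ 0) ?oppr_le0// addr_ge0.
Qed.

Lemma clamp_range (r : R) W z : 0 <= r -> - r <= clamp r W z <= 1 + r.
Proof.
by move=> r0; rewrite le_max ge_max ge_min !lexx/= andbT; lra.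
Qed.

Lemma clamp_id (r : R) W z : - r <= W z <= 1 + r -> clamp r W z = W z.
Proof.
by move=> /andP[Wr W1]; rewrite /clamp (min_idPr W1) (max_idPr Wr).
Qed.

Lemma dist_clamp (r : R) W z : 0 <= r -> `|clamp r W z - clamp 0 W z| <= r.
Proof.
move=> r0; rewrite ler_norml /clamp !maxEle !minEle.
have [h1|h1] := leP (1 + r) (W z); have [h2|h2] := leP (1 + 0) (W z);
  have [h3|h3] := leP (- r) (1 + r); have [h4|h4] := leP (- r) (W z);
  have [h5|h5] := leP (- 0 : R) (1 + 0); have [h6|h6] := leP (- 0) (W z);
  lra.
Qed.

Lemma clamp01 W z : 0 <= clamp 0 W z <= 1.
Proof. by have := @clamp_range 0 W z (lexx 0); rewrite oppr0 addr0. Qed.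

Lemma graphon_clamp W : is_graphon P W -> \forall z \ae PP, W z = clamp 0 W z.
Proof.
move=> [_]; apply: filterS => z W01; rewrite clamp_id//.
by rewrite oppr0 addr0.
Qed.

Lemma cut_le_ae_bounded E (e : R) : 0 <= e -> bmeas E ->
  (\forall z \ae PP, `|E z| <= e) -> cut_le P E e.
Proof.
move=> e0 bE Ee; have [mE _] := bE.
pose E' z := Num.max (- e) (Num.min e (E z)).
have ee : - e <= e by rewrite (@le_trans _ _ 0) ?oppr_le0.
have bE' : bmeas E' by exact: bmeas_clamp.
apply: (cut_le_ae bE' bE).
  apply: filterS Ee => z; rewrite ler_norml => /andP[E1 E2].
  by rewrite /E' (min_idPr E2) (max_idPr E1).
have E'e z : `|E' z| <= e.
  by rewrite ler_norml le_max ge_max ge_min !lexx ee.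
move=> A B mA mB; rewrite integral_rectangle//.
have ind1 S (u : Omega) : `|\1_S u : R| <= 1.
  by rewrite indicE; case: (u \in S); rewrite /= ?normr1 ?normr0.
have bAB : bmeas (fun z : Omega * Omega => E' z * (\1_A z.1 * \1_B z.2 : R)).
  apply: bmeasM => //; apply: bmeasM.
  - by apply: (bmeas_comp (bmeas_indic R mA)).
  - by apply: (bmeas_comp (bmeas_indic R mB)).
apply: normr_bintegral_le => [|u]; first exact: (bmeas_integral P bAB).
apply: normr_bintegral_le => [|v]; first exact: (bmeas_comp bAB (pair1_measurable u)).
rewrite !normrM -[leRHS]mulr1; apply: ler_pM; rewrite ?mulr_ge0//.
by rewrite -[leRHS]mulr1; apply: ler_pM.
Qed.

Lemma cut_le_perturb D D' (c e : R) : 0 <= e -> bmeas D -> bmeas D' ->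
  cut_le P D c -> (\forall z \ae PP, `|D' z - D z| <= e) -> cut_le P D' (c + e).
Proof.
move=> e0 bD bD' Dc DD'.
have -> : D' = fun z => D z + (D' z - D z) by apply/funext => z; rewrite subrKC.
by apply: cut_leD => //; [exact: bmeasB|apply: cut_le_ae_bounded => //; exact: bmeasB].
Qed.

Variables (k : nat) (rule : lgraph k -> lgraph k -> R).
Hypothesis rule_ok : is_rule rule.
Local Notation V := (velocity P rule).

Lemma solution_increment W (D : set R) Phi t (e : R) : is_solution P rule W D Phi ->
  D t -> 0 < e -> exists2 dl : R, 0 < dl & forall h : R, h != 0 -> `|h| < dl ->
    \forall z \ae PP, `|Phi (t + h) z - (Phi t z + h * V (Phi t) z)| <= e * `|h|.
Proof. by move=> [_ _ _ dPhi] /dPhi; exact: Linfty_derivative_increment. Qed.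

Lemma solution_continuous W (D : set R) Phi t (e : R) : is_solution P rule W D Phi ->
  D t -> 0 < e -> exists2 dl : R, 0 < dl & forall h : R, h != 0 -> `|h| < dl ->
    \forall z \ae PP, `|Phi (t + h) z - Phi t z| <= e.
Proof.
move=> sol Dt e0; have [_ kPhi _ _] := sol.
have [_ [K VK]] := bmeas_velocity P rule (kernel_bmeas (kPhi _ Dt)).
have K0 : 0 <= K by exact: le_trans (VK point).
have [dl dl0 Hdl] := solution_increment sol Dt ltr01.
(* With error rate 1 and velocity at most [K], the increment is at most [(1 + K) * |h|]. *)
exists (Num.min dl (e / (1 + K))) => [|h h0].
  by rewrite lt_min dl0 divr_gt0// ltr_wpDr.
rewrite lt_min ltr_pdivlMr; last by rewrite ltr_wpDr.
move=> /andP[hdl hK]; apply: filterS (Hdl h h0 hdl) => z Hz.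
have := ler_pM (normr_ge0 _) (normr_ge0 _) (lexx `|h|) (VK z).
rewrite -normrM => HV.
have -> : Phi (t + h) z - Phi t z =
    Phi (t + h) z - (Phi t z + h * V (Phi t) z) + h * V (Phi t) z by ring.
rewrite (le_trans (ler_normD _ _))//; lra.
Qed.

Lemma graphon_forward W (D : set R) Phi (a b : R) : is_solution P rule W D Phi ->
  D a -> D b -> a <= b -> is_graphon P (Phi a) -> is_graphon P (Phi b).
Proof.
move=> sol Da Db ab [_ Wa]; have [[_ iD _] kPhi _ _] := sol.
split; first exact: kPhi.
have Dab t : a <= t <= b -> D t by move=> abt; exact: iD abt.
(* [Q t r] bounds by [r] the essential distance from [Phi t] to the [0,1]-valued kernels. *)
pose Q t r := \forall z \ae PP, - r <= Phi t z <= 1 + r.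
have Qmono t r r' : r <= r' -> Q t r -> Q t r'.
  by move=> rr'; apply: filterS => z; lra.
have Qclosed t r : (forall e, 0 < e -> Q t (r + e)) -> Q t r.
  (* Only countably many a.e. statements can be intersected, so [e] runs through the numbers
     [1 / (n + 1)]. *)
  move=> He; have /ae_foralln : forall n, Q t (r + n.+1%:R^-1).
    by move=> n; apply: He; rewrite invr_gt0.
  apply: filterS => z Hz.
  have small e : 0 < e -> - (r + e) <= Phi t z <= 1 + (r + e).
    move=> e0; have [n ne] : exists n, n.+1%:R^-1 < e.
      by exists (Num.truncn e^-1); rewrite invf_plt ?posrE// truncnS_gt.
    by move: (n.+1%:R^-1) ne (Hz n) => x; lra.
  rewrite lerNl; apply/andP; split; apply/ler_addgt0Pr => e /small; lra.
have Q0 : Q a 0 by apply: filterS Wa => z; rewrite oppr0 addr0.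
suff : Q b 0 by apply: filterS => z; rewrite oppr0 addr0.
(* Radius 2 covers [[-r, 1 + r]] for all [r <= 1], the range to which the Gronwall argument is
   confined. *)
have [L L0 lipV] := velocity_lipschitz P rule_ok (ler0n R 2).
apply: (Qclosed b 0) => e e0; rewrite add0r.
pose X := expR ((L + 1) * (b - a)).
have X0 : 0 < X by exact: expR_gt0.
(* Gronwall's inequality needs a positive initial bound. This one grows to exactly [Num.min e 1]: at
   most [e] as required, and at most 1 to stay in the range of [lipV]. *)
pose c := Num.min e 1 / X.
have c0 : 0 < c by rewrite divr_gt0// lt_min e0 ltr01.
have cX : c * X = Num.min e 1 by rewrite divfK// gt_eqF.
apply: (Qmono b (c * X)); first by rewrite cX ge_min lexx.
apply: (gronwall_growth (M := 1)) => //; rewrite -/X.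
- by rewrite cX ge_min lexx orbT.
- by move=> t r _; exact: Qclosed.
- exact: Qmono (ltW c0) Q0.
- move=> t /andP[at_ tb] e' e'0.
  have Dt : D t by apply: Dab; rewrite ltW.
  have [dl dl0 Hdl] := solution_continuous sol Dt e'0.
  exists dl => // h r /andP[h0 hdl] _ Qr.
  have := Hdl (- h); rewrite oppr_eq0 normrN gtr0_norm// gt_eqF// => /(_ isT hdl).
  move: Qr; apply: filterS2 => z; rewrite ler_norml; lra.
move=> t /andP[at_ tb] r /andP[r0 r1] Qr e' e'0.
have Dt : D t by apply: Dab; rewrite at_ ltW.
have [dl dl0 Hdl] := solution_increment sol Dt e'0.
have N0 := num_terms_ge0 R k; set N := num_terms R k in N0.
have bW := kernel_bmeas (kPhi _ Dt); have [_ _ symW] := kPhi _ Dt.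
set Wt := Phi t in Qr bW symW Hdl *.
(* The second bound gives [h * N <= 1], so that by [velocity_inward] the Euler step from
   [clamp 0 Wt] stays in [0,1]. *)
exists (Num.min dl (1 + N)^-1) => [|h /andP[h0]].
  by rewrite lt_min dl0 invr_gt0 ltr_wpDr.
rewrite lt_min => /andP[hdl hN] _.
have hN1 : h * N <= 1.
  have : h * (1 + N) < 1 by rewrite -ltr_pdivlMr ?div1r// ltr_wpDr.
  by rewrite mulrDr mulr1; lra.
have bW1 := bmeas_clampW (ltW r0) bW; have bW0 := bmeas_clampW (lexx 0) bW.
have W1M z : `|clamp r Wt z| <= 2.
  by rewrite ler_norml; have := @clamp_range r Wt z (ltW r0); lra.
have W0M z : `|clamp 0 Wt z| <= 2.
  by rewrite ler_norml; have := @clamp01 Wt z; lra.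
have WW1 : \forall z \ae PP, Wt z = clamp r Wt z.
  by apply: filterS Qr => z; move=> /clamp_id ->.
have VW1 := velocity_ae rule bW bW1 WW1.
have h0' : h != 0 by rewrite gt_eqF.
have := Hdl h h0'; rewrite gtr0_norm// => /(_ hdl).
have near1 : \forall z \ae PP, Wt z = clamp r Wt z /\ V Wt z = V (clamp r Wt) z.
  by move: WW1 VW1; apply: filterS2 => z.
move=> near2; move: near2 near1 symW.
apply: filterS3 => z + [Wz Vz] symz.
have sym0 : clamp 0 Wt (z.1, z.2) = clamp 0 Wt (z.2, z.1) by rewrite /clamp symz.
have := velocity_inward P rule_ok bW0 (@clamp01 Wt) sym0.
have := lipV _ _ r bW1 bW0 W1M W0M (fun z => dist_clamp Wt z (ltW r0)) z.
have := dist_clamp Wt z (ltW r0); have := @clamp01 Wt z.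
rewrite !ler_norml Wz Vz -/N.
(* The step [w1 + h * v1] differs from [w0 + h * v0], which lies in [0,1], by at most
   [r + h * (L * r)]; the true trajectory adds the error [e' * h]. *)
set w0 := clamp 0 Wt z; set w1 := clamp r Wt z.
set v1 := V (clamp r Wt) z; set v0 := V (clamp 0 Wt) z.
move=> /andP[w00 w01] /andP[w1l w1u] /andP[v1l v1u] /andP[v0l v0u] /andP[xl xu].
have := ler_wpM2l (ltW h0) v1l; have := ler_wpM2l (ltW h0) v1u.
have := ler_wpM2l (ltW h0) v0l; have := ler_wpM2l (ltW h0) v0u.
have w01' : 0 <= 1 - w0 by rewrite subr_ge0.
have := ler_wpM2r w00 hN1; have := ler_wpM2r w01' hN1.
nra.
Qed.

Lemma velocity_clamp W : is_graphon P W ->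
  \forall z \ae PP, V W z = V (clamp 0 W) z.
Proof.
move=> gW; have bW := kernel_bmeas gW.1.
by apply: velocity_ae => //; [exact: bmeas_clampW|exact: graphon_clamp].
Qed.

(** * Growth of the cut distance between two trajectories *)

Section two_solutions.
Variables (U W : Omega * Omega -> R) (DU DW : set R)
  (PhiU PhiW : R -> Omega * Omega -> R).
Hypothesis solU : is_solution P rule U DU PhiU.
Hypothesis solW : is_solution P rule W DW PhiW.
Local Notation diff t := (fun z => PhiU t z - PhiW t z).
Local Notation C := ((C_square k)%:R : R).

Lemma bmeas_diff t : DU t -> DW t -> bmeas (diff t).
Proof.
have [_ kU _ _] := solU; have [_ kW _ _] := solW.
by move=> /kU/kernel_bmeas bU /kW/kernel_bmeas bW; exact: bmeasB.
Qed.

(** [h] may have either sign, only [|h|] entering the bound, so the same estimate serves both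
    directions of time. Each trajectory contributes an error rate [e / 2]. *)
Lemma cut_increment t (r e : R) : DU t -> DW t ->
  is_graphon P (PhiU t) -> is_graphon P (PhiW t) -> cut_le P (diff t) r -> 0 < e ->
  exists2 dl : R, 0 < dl & forall h : R, h != 0 -> `|h| < dl ->
    DU (t + h) -> DW (t + h) ->
    cut_le P (diff (t + h)) (r * (1 + C * `|h|) + e * `|h|).
Proof.
move=> DUt DWt gU gW Qr e0; have e20 : 0 < e / 2 by rewrite divr_gt0.
have [dU dU0 HU] := solution_increment solU DUt e20.
have [dW dW0 HW] := solution_increment solW DWt e20.
exists (Num.min dU dW) => [|h h0]; first by rewrite lt_min dU0.
rewrite lt_min => /andP[hU hW] DUh DWh.
have bU := kernel_bmeas gU.1; have bW := kernel_bmeas gW.1.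
have bU0 := bmeas_clampW (lexx 0) bU; have bW0 := bmeas_clampW (lexx 0) bW.
have cutV : cut_le P (fun z => V (clamp 0 (PhiU t)) z - V (clamp 0 (PhiW t)) z) (C * r).
  apply: cut_velocity => //; [by move=> z; exact: clamp01..|].
  apply: cut_le_ae Qr; [exact: bmeasB|exact: bmeasB|].
  by move: (graphon_clamp gU) (graphon_clamp gW); apply: filterS2 => z -> ->.
have bV : bmeas (fun z => V (clamp 0 (PhiU t)) z - V (clamp 0 (PhiW t)) z).
  by apply: bmeasB; exact: bmeas_velocity.
have bhV : bmeas (fun z => h * (V (clamp 0 (PhiU t)) z - V (clamp 0 (PhiW t)) z)).
  by apply: bmeasM => //; exact: bmeas_cst.
have -> : r * (1 + C * `|h|) + e * `|h| = (r + `|h| * (C * r)) + e * `|h| by ring.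
apply: (cut_le_perturb (D := fun z => (PhiU t z - PhiW t z) +
    h * (V (clamp 0 (PhiU t)) z - V (clamp 0 (PhiW t)) z))).
- by rewrite mulr_ge0// ltW.
- by apply: bmeasD => //; exact: bmeasB.
- exact: bmeas_diff.
- by apply: cut_leD => //; [exact: bmeasB|exact: cut_leZ].
have VUW : \forall z \ae PP, V (PhiU t) z = V (clamp 0 (PhiU t)) z /\
    V (PhiW t) z = V (clamp 0 (PhiW t)) z.
  by move: (velocity_clamp gU) (velocity_clamp gW); apply: filterS2 => z.
move: (HU h h0 hU) (HW h h0 hW) VUW; apply: filterS3 => z HUz HWz [<- <-].
have -> : PhiU (t + h) z - PhiW (t + h) z -
    (PhiU t z - PhiW t z + h * (V (PhiU t) z - V (PhiW t) z)) =
    (PhiU (t + h) z - (PhiU t z + h * V (PhiU t) z)) -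
    (PhiW (t + h) z - (PhiW t z + h * V (PhiW t) z)) by ring.
rewrite (le_trans (ler_normB _ _))//; lra.
Qed.

Lemma cut_continuous t (e : R) : DU t -> DW t -> 0 < e ->
  exists2 dl : R, 0 < dl & forall h r : R, h != 0 -> `|h| < dl ->
    DU (t + h) -> DW (t + h) -> cut_le P (diff (t + h)) r -> cut_le P (diff t) (r + e).
Proof.
move=> DUt DWt e0; have e20 : 0 < e / 2 by rewrite divr_gt0.
have [dU dU0 HU] := solution_continuous solU DUt e20.
have [dW dW0 HW] := solution_continuous solW DWt e20.
exists (Num.min dU dW) => [|h r h0]; first by rewrite lt_min dU0.
rewrite lt_min => /andP[hU hW] DUh DWh Qr.
apply: cut_le_perturb (ltW e0) _ _ Qr _; [exact: bmeas_diff|exact: bmeas_diff|].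
move: (HU h h0 hU) (HW h h0 hW); apply: filterS2 => z.
rewrite !ler_norml; lra.
Qed.

(* [sg] is the direction of time. *)
Lemma cut_growth (sg T c : R) : `|sg| = 1 -> 0 <= T ->
  (forall s, 0 <= s <= T -> [/\ DU (sg * s), DW (sg * s),
     is_graphon P (PhiU (sg * s)) & is_graphon P (PhiW (sg * s))]) ->
  cut_le P (diff 0) c -> cut_le P (diff (sg * T)) (c * expR (C * T)).
Proof.
move=> sg1 T0 Hs Qc; have c0 := cut_le_ge0 Qc.
have sg0 : sg != 0 by rewrite -normr_eq0 sg1 oner_eq0.
(* One [eta] does two jobs: it makes the initial bound positive even when [c = 0], and it is the
   slack in the exponent. It tends to 0 at the end. *)
have growth eta : 0 < eta ->
    cut_le P (diff (sg * T)) ((c + eta) * expR ((C + eta) * T)).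
  move=> eta0; have c1 : 0 < c + eta by rewrite ltr_wpDl.
  pose Q s r := cut_le P (diff (sg * s)) r.
  rewrite -/(Q T _) -[in X in expR X](subr0 T).
  (* [cut_increment] holds for every [r], so [M] can be the final bound itself. *)
  apply: (gronwall_growth (M := (c + eta) * expR ((C + eta) * (T - 0)))) => //.
  - by move=> s r r' rr' Qr A B mA mB; exact: le_trans (Qr A B mA mB) rr'.
  - move=> s r _ Qr A B mA mB; apply/ler_addgt0Pr => e e0; exact: Qr.
  - move=> A B mA mB; rewrite mulr0; apply: le_trans (Qc A B mA mB) _.
    by rewrite lerDl ltW.
  - move=> s /andP[s0 sT] e e0.
    have [|DUs DWs _ _] := Hs s; first by rewrite ltW.
    have [dl dl0 Hdl] := cut_continuous DUs DWs e0.
    exists dl => // h r /andP[h0 hdl] sh Qr.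
    have [|DUh DWh _ _] := Hs (s - h); first by rewrite sh (le_trans _ sT)// gerBl ltW.
    have shE : sg * (s - h) = sg * s + - (sg * h) by ring.
    rewrite shE in DUh DWh; rewrite /Q shE in Qr.
    apply: (Hdl (- (sg * h))) => //.
      by rewrite oppr_eq0 mulf_neq0// gt_eqF.
    by rewrite normrN normrM sg1 mul1r gtr0_norm.
  move=> s /andP[s0 sT] r _ Qr e e0.
  have [|DUs DWs gU gW] := Hs s; first by rewrite s0 ltW.
  have [dl dl0 Hdl] := cut_increment DUs DWs gU gW Qr e0.
  exists dl => // h /andP[h0 hdl] sh.
  have [|DUh DWh _ _] := Hs (s + h); first by rewrite sh addr_ge0// ltW.
  have hE : `|sg * h| = h by rewrite normrM sg1 mul1r gtr0_norm.
  rewrite mulrDr in DUh DWh.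
  have := Hdl (sg * h); rewrite /Q (mulrDr sg) hE; apply => //.
  by rewrite mulf_neq0// gt_eqF.
move=> A B mA mB.
have cont : (c + eta) * expR ((C + eta) * T) @[eta --> 0^'+] --> c * expR (C * T).
  rewrite -[in X in _ --> X](addr0 c) -[in X in _ --> X](addr0 C).
  apply: cvg_at_right_filter; apply: cvgM.
    by apply: cvgD; [exact: cvg_cst|exact: cvg_id].
  apply: continuous_cvg; first exact: continuous_expR.
  by apply: cvgM; [apply: cvgD; [exact: cvg_cst|exact: cvg_id]|exact: cvg_cst].
apply: (cvgr_to_ge cont); near=> eta.
exact: (growth eta).
Unshelve. all: by end_near.
Qed.

End two_solutions.

End flow.

(** * From rectangle bounds back to the cut norm, and the conclusion *)

(** Boundedness of [D] bounds the integrals over rectangles, so that [sup] is a true supremum and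
    not a default value. *)
Lemma cut_le_cut_norm d (Omega : measurableType d) (R : realType)
    (P : probability Omega R) (D : Omega * Omega -> R) : bmeas D ->
  cut_le P D (cut_norm P D).
Proof.
move=> bD A B mA mB; have [_ [M DM]] := bD.
have M0 : 0 <= M by exact: le_trans (DM point).
apply: ub_le_sup; last by exists (A, B).
exists M => _ [[A' B'] /= [mA' mB'] <-].
apply: (cut_le_ae_bounded M0 bD) => //.
by apply: nearW.
Qed.

Lemma cut_norm_le d (Omega : measurableType d) (R : realType)
    (P : probability Omega R) (D : Omega * Omega -> R) (c : R) :
  cut_le P D c -> cut_norm P D <= c.
Proof.
move=> Dc; apply: ge_sup.
  exists `|\int[(P \x P)%E]_(z in setT `*` setT) D z|.
  by exists (setT, setT) => //; split; exact: measurableT.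
by move=> _ [[A B] /= [mA mB] <-]; exact: Dc.
Qed.

Theorem theorem4p16 (R : realType) (d : measure_display)
    (Omega : measurableType d) (P : probability Omega R)
    (P_atomless : atomless P) (P_separable : separable_space P)
    (k : nat) (rule : lgraph k -> lgraph k -> R) (rule_ok : is_rule rule)
    (U W : Omega * Omega -> R) (hU : is_graphon P U) (hW : is_graphon P W)
    (D_U D_W : set R) (Phi_U Phi_W : R -> Omega * Omega -> R)
    (solU : is_maximal_solution P rule U D_U Phi_U)
    (solW : is_maximal_solution P rule W D_W Phi_W)
    (t : R) (tI : (graphon_times P D_U Phi_U `&` graphon_times P D_W Phi_W) t) :
  cut_norm P (Phi_U t \- Phi_W t)
    <= expR ((C_square k)%:R * `|t|) * cut_norm P (U \- W).
Proof.
case: solU => sU _; case: solW => sW _.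
have [[DUt gUt] [DWt gWt]] := tI.
have [[_ iU DU0] kU U0 _] := sU; have [[_ iW DW0] kW W0 _] := sW.
(* A trajectory agrees with its initial kernel only a.e. at time 0, so being a graphon is
   transferred to its value there. *)
have start V (V0 : Omega * Omega -> R) : is_graphon P V -> is_kernel P V0 ->
    (\forall z \ae (P \x P)%E, V0 z = V z) -> is_graphon P V0.
  move=> [_ V01] kV V0V; split => //.
  by move: V01 V0V; apply: filterS2 => z + ->.
have gU0 := start _ _ hU (kU _ DU0) U0.
have gW0 := start _ _ hW (kW _ DW0) W0.
have bU := kernel_bmeas hU.1; have bW := kernel_bmeas hW.1.
have c0 : cut_le P (fun z => Phi_U 0 z - Phi_W 0 z) (cut_norm P (U \- W)).
  apply: (@cut_le_ae _ _ _ P (U \- W)).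
  - exact: bmeasB.
  - by apply: bmeasB; [exact: (kernel_bmeas gU0.1)|exact: (kernel_bmeas gW0.1)].
  - by move: U0 W0; apply: filterS2 => z /= -> ->.
  - exact/cut_le_cut_norm/bmeasB.
apply: cut_norm_le; rewrite mulrC.
have [t0|t0] := leP 0 t.
  rewrite -[in X in cut_le _ X _](mul1r t) ger0_norm//.
  apply: (cut_growth rule_ok sU sW) => //; first by rewrite normr1.
  move=> s /andP[s0 st]; rewrite !mul1r.
  have DUs : D_U s by apply: (iU 0 t) => //; rewrite s0.
  have DWs : D_W s by apply: (iW 0 t) => //; rewrite s0.
  split => //; [exact: (graphon_forward rule_ok sU DU0)|].
  exact: (graphon_forward rule_ok sW DW0).
have tN : -1 * `|t| = t by rewrite ltr0_norm// mulN1r opprK.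
rewrite -[in X in cut_le _ X _]tN.
apply: (cut_growth rule_ok sU sW) => //; first by rewrite normrN normr1.
move=> s /andP[s0 st]; rewrite !mulN1r.
have ts : t <= - s by rewrite lerNr -(ltr0_norm t0).
have sN0 : - s <= 0 by rewrite oppr_le0.
have DUs : D_U (- s) by apply: (iU t 0) => //; rewrite ts.
have DWs : D_W (- s) by apply: (iW t 0) => //; rewrite ts.
split => //; [exact: (graphon_forward rule_ok sU DUt)|].
exact: (graphon_forward rule_ok sW DWt).
Qed.
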